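(* Let $M$ be a seven-dimensional Riemannian manifold equipped with a $G_2$-structure with intrinsic torsion $\xi$, and let $s$ be its scalar curvature. Then $$s = 9 \|\xi_{(1)} \|^2 - \tfrac32 \|\xi_{(2)} \|^2 - \tfrac32 \|\xi_{(3)} \|^2+ \tfrac{15}2 \|\xi_{(4)} \|^2 - 6\, \mathrm{div} \Big(\sum_{i\in\mathbb Z_7} \xi_{e_i} e_i\Big),$$ where $\{e_0,\dots,e_6\}$ is any local Cayley frame (the vector field $\sum_i\xi_{e_i}e_i$ does not depend on the choice of orthonormal frame).
   Context: Indices are taken in $\mathbb Z_7$. A $G_2$-structure on a Riemannian 7-manifold $(M,\langle\cdot,\cdot\rangle)$ is a reduction of the orthonormal frame bundle to $G_2$; equivalently, a global three-form $\varphi$ such that around each point there is a local orthonormal frame $\{e_0,\dots,e_6\}$ (a Cayley frame) with dual coframe $\{e_i^*\}$ and $\varphi=\sum_{i\in\mathbb Z_7} e_i^*\wedge e_{i+1}^*\wedge e_{i+3}^*$. The vector cross product is defined by $\langle X\times Y,Z\rangle=\varphi(X,Y,Z)$. Let $\nabla$ be the Levi-Civita connection. Write $\mathfrak{so}(TM)=\mathfrak g_2\oplus\mathfrak g_2^\perp$, where $\mathfrak g_2$ is the subalgebra of skew endomorphisms $a$ with $a(u\times v)=a(u)\times v+u\times a(v)$, and $\mathfrak g_2^\perp$ is its orthogonal complement in $\mathfrak{so}(TM)$. The minimal connection $\nabla^{G_2}$ is the unique connection preserving the $G_2$-structure such that $\xi_X=\nabla^{G_2}_X-\nabla_X\in\mathfrak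 g_2^\perp$ for all $X$; $\xi$ is the intrinsic torsion. There is a unique endomorphism field $T$ of $TM$ with $\xi_XY=Y\times T(X)$. Any endomorphism $a$ of $T_mM$ decomposes orthogonally into $G_2$-components $a=a_{(1)}+a_{(2)}+a_{(3)}+a_{(4)}$, where $a_{(1)}=\frac17\mathrm{tr}(a)\,\mathrm{Id}$, $a_{(3)}$ is the trace-free symmetric part of $a$, and $a_{(2)}\in\mathfrak g_2$, $a_{(4)}\in\mathfrak g_2^\perp$ are the components of the skew part of $a$. The $G_2$-components of $\xi$ are $(\xi_{(k)})_XY=Y\times T_{(k)}(X)$, $k=1,2,3,4$. Norms are the tensor norms: $\|\xi_{(k)}\|^2=\sum_{i,j}\|(\xi_{(k)})_{e_i}e_j\|^2$. *)

(* Defs.v *)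
From HB Require Import structures.
From mathcomp Require Import all_boot all_order all_algebra.
From mathcomp Require Import all_classical all_reals all_analysis.

Set Implicit Arguments.
Unset Strict Implicit.
Unset Printing Implicit Defensive.

Import Order.TTheory GRing.Theory Num.Theory.
Import numFieldNormedType.Exports.

Local Open Scope classical_set_scope.
Local Open Scope ring_scope.

(* C^k maps on an open set U of a finite-dimensional space.  In finite
   dimension the differential is C^k as an operator-valued map iff it is C^k
   after evaluation at each vector v. *)
Fixpoint Ck_on (R : realType) (V W : normedModType R) (k : nat)
    (U : set V) (f : V -> W) : Prop :=
  match k with
  | 0 => forall x, U x -> {for x, continuous f}
  | k'.+1 => (forall x, U x -> differentiable f x) /\
             (forall v : V, Ck_on k' U (fun x => 'd f x v))
  end.

Definition smooth_on (R : realType) (V W : normedModType R)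
    (U : set V) (f : V -> W) : Prop := forall k, Ck_on k U f.

(* Homeomorphisms from an open set of M onto an open set of R^n.  Both maps
   are total; their values outside chart_dom and chart_cod are irrelevant. *)
Record chart (R : realType) (n : nat) (M : topologicalType) := Chart {
  chart_dom : set M;
  chart_cod : set 'rV[R]_n;
  chart_map :> M -> 'rV[R]_n;
  chart_inv : 'rV[R]_n -> M;
  chart_dom_open : open chart_dom;
  chart_cod_open : open chart_cod;
  chart_map_cod : forall p, chart_dom p -> chart_cod (chart_map p);
  chart_inv_dom : forall x, chart_cod x -> chart_dom (chart_inv x);
  chart_mapK : forall p, chart_dom p -> chart_inv (chart_map p) = p;
  chart_invK : forall x, chart_cod x -> chart_map (chart_inv x) = x;
  chart_map_continuous : forall p, chart_dom p -> {for p, continuous chart_map};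
  chart_inv_continuous : forall x, chart_cod x -> {for x, continuous chart_inv}
}.

(* Smooth n-manifolds.  The chart chart_at p is a choice of one chart of the
   atlas around p; it serves to represent the tangent space at p. *)
Record manifold (R : realType) (n : nat) := Manifold {
  mcarrier :> topologicalType;
  mhausdorff : hausdorff_space mcarrier;
  msecond_countable : @second_countable mcarrier;
  atlas : set (chart R n mcarrier);
  chart_at : mcarrier -> chart R n mcarrier;
  chart_at_atlas : forall p, atlas (chart_at p);
  chart_at_dom : forall p, chart_dom (chart_at p) p;
  atlas_compatible : forall c c', atlas c -> atlas c' ->
    smooth_on (chart_cod c `&` chart_inv c @^-1` chart_dom c')
              (c' \o chart_inv c)
}.

Section SmoothManifold.
Context {R : realType} {n : nat} {M : manifold R n}.

(* T_pM is 'rV[R]_n: a row vector v stands for the tangent vector at p whose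
   components in the chart chart_at p are v.  Hence M -> 'rV[R]_n is the type
   of (not necessarily smooth) vector fields, and an endomorphism of T_pM is a
   matrix acting on row vectors by v |-> v *m a. *)
Implicit Types (p q : M) (u v w : 'rV[R]_n) (X Y Z : M -> 'rV[R]_n).
Implicit Types (nabla : (M -> 'rV[R]_n) -> M -> 'rV[R]_n -> 'rV[R]_n).

(* In the following predicates U is meant to be an open set. *)
Definition smooth_map (W : normedModType R) (U : set M) (f : M -> W) : Prop :=
  forall c, @atlas R n M c ->
    smooth_on (chart_cod c `&` chart_inv c @^-1` U) (f \o chart_inv c).

(* df_p(v) *)
Definition tdiff (W : normedModType R) (f : M -> W) p v : W :=
  'd (f \o chart_inv (chart_at p)) (chart_at p p) v.

(* For p in the domain of c, tdiff c p v is the vector of components of the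
   tangent vector v in the chart c. *)
Definition smooth_field (U : set M) X : Prop :=
  forall c, @atlas R n M c ->
    smooth_on (chart_cod c `&` chart_inv c @^-1` U)
              (fun x => tdiff c (chart_inv c x) (X (chart_inv c x))).

(* [X, Y]^k = X^i d_i Y^k - Y^i d_i X^k at p, in the chart chart_at p *)
Definition lie_bracket X Y p : 'rV[R]_n :=
  tdiff (fun q => tdiff (chart_at p) q (Y q)) p (X p)
  - tdiff (fun q => tdiff (chart_at p) q (X q)) p (Y p).

(* The vector field on the domain of chart_at p with constant components v in
   the chart chart_at p. *)
Definition coord_field p v : M -> 'rV[R]_n := fun q =>
  'd (chart_at q \o chart_inv (chart_at p)) (chart_at p q) v.

(* Affine connections on TM: nabla Y p v is the value at p of the covariant
   derivative of Y along v.  The axioms concern fields Y smooth near p only.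
   Taking f locally constant in the Leibniz rule shows that nabla Y p depends
   on the germ of Y at p only, so that this is the same datum as a connection
   acting on globally defined vector fields. *)
Definition is_connection nabla : Prop :=
  forall U : set M, open U ->
  [/\ forall Y, smooth_field U Y -> forall p, U p -> linear (nabla Y p),
      forall Y Z, smooth_field U Y -> smooth_field U Z ->
        forall p v, U p ->
        nabla (fun q => Y q + Z q) p v = nabla Y p v + nabla Z p v,
      forall (f : M -> R) Y, smooth_map U f -> smooth_field U Y ->
        forall p v, U p ->
        nabla (fun q => f q *: Y q) p v = tdiff f p v *: Y p + f p *: nabla Y p v
    & forall X Y, smooth_field U X -> smooth_field U Y ->
        smooth_field U (fun q => nabla Y q (X q))].

Record riemannian_metric := RiemannianMetric {
  (* Gram matrix of the coordinate basis of T_pM *)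
  gram : M -> 'M[R]_n;
  gram_sym : forall p, (gram p)^T = gram p;
  gram_pos : forall p v, v != 0 -> 0 < (v *m gram p *m v^T) 0 0;
  gram_smooth : forall (U : set M) X Y, open U ->
    smooth_field U X -> smooth_field U Y ->
    smooth_map U (fun q => (X q *m gram q *m (Y q)^T) 0 0 : R)
}.

Definition dot (g : riemannian_metric) p u v : R := (u *m gram g p *m v^T) 0 0.

Definition metric_connection (g : riemannian_metric) nabla : Prop :=
  forall (U : set M) Y Z, open U -> smooth_field U Y -> smooth_field U Z ->
  forall p v, U p ->
  tdiff (fun q => dot g q (Y q) (Z q)) p v =
    dot g p (nabla Y p v) (Z p) + dot g p (Y p) (nabla Z p v).

Definition torsion_free nabla : Prop :=
  forall (U : set M) X Y, open U -> smooth_field U X -> smooth_field U Y ->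
  forall p, U p ->
  nabla Y p (X p) - nabla X p (Y p) = lie_bracket X Y p.

Definition levi_civita (g : riemannian_metric) nabla : Prop :=
  [/\ is_connection nabla, metric_connection g nabla & torsion_free nabla].

(* R(X, Y)Z = nabla_X nabla_Y Z - nabla_Y nabla_X Z - nabla_[X, Y] Z *)
Definition curvature nabla X Y Z p : 'rV[R]_n :=
  nabla (fun q => nabla Z q (Y q)) p (X p)
  - nabla (fun q => nabla Z q (X q)) p (Y p)
  - nabla Z p (lie_bracket X Y p).

(* The curvature being tensorial, R(u, v)w is computed by extending u, v, w to
   vector fields near p. *)
Definition curvature_at nabla p u v w : 'rV[R]_n :=
  curvature nabla (coord_field p u) (coord_field p v) (coord_field p w) p.

(* Ric(v, w) = tr (u |-> R(u, v)w) *)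
Definition ricci nabla p v w : R :=
  \sum_(k < n) (curvature_at nabla p (delta_mx 0 k) v w) 0 k.

(* s = g^{ij} Ric_{ij} *)
Definition scalar_curvature (g : riemannian_metric) nabla p : R :=
  \sum_(i < n) \sum_(j < n)
    invmx (gram g p) i j * ricci nabla p (delta_mx 0 i) (delta_mx 0 j).

(* div X = tr (v |-> nabla_v X) *)
Definition divergence nabla X p : R :=
  \sum_(k < n) (nabla X p (delta_mx 0 k)) 0 k.

Definition orthonormal_basis (g : riemannian_metric) p (b : 'I_n -> 'rV[R]_n)
  : Prop := forall i j, dot g p (b i) (b j) = (i == j)%:R.

(* The dual basis: b_i^*(u) is the coefficient of b_i in u. *)
Definition dual_basis (b : 'I_n -> 'rV[R]_n) (i : 'I_n) u : R :=
  (u *m invmx (\matrix_j b j)) 0 i.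

Definition skew_endo (g : riemannian_metric) p (a : 'M[R]_n) : Prop :=
  forall u v, dot g p (u *m a) v = - dot g p u (v *m a).

Definition sym_endo (g : riemannian_metric) p (a : 'M[R]_n) : Prop :=
  forall u v, dot g p (u *m a) v = dot g p u (v *m a).

(* The adjoint of v |-> v *m a with respect to dot g p. *)
Definition adjoint_endo (g : riemannian_metric) p (a : 'M[R]_n) : 'M[R]_n :=
  gram g p *m a^T *m invmx (gram g p).

(* The inner product of endomorphisms of T_pM, as tensors. *)
Definition dot_endo (g : riemannian_metric) p (a b : 'M[R]_n) : R :=
  \tr (a *m adjoint_endo g p b).

End SmoothManifold.

Arguments riemannian_metric {R n} M.

(* (alpha /\ beta /\ gamma)(u, v, w), with the determinant convention: it is 1
   if alpha, beta, gamma and u, v, w are dual bases of each other. *)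
Definition wedge3 (R : realType) (V : Type) (alpha beta gamma : V -> R)
    (u v w : V) : R :=
  \det (\matrix_(i < 3, j < 3)
    (nth alpha [:: alpha; beta; gamma] i) (nth u [:: u; v; w] j)).

Section G2Structure.
Context {R : realType} {M : manifold R 7}.
Implicit Types (g : riemannian_metric M) (p q : M) (u v w : 'rV[R]_7).
Implicit Types (X Y Z : M -> 'rV[R]_7) (a b : 'M[R]_7).
Implicit Types (phi : M -> 'rV[R]_7 -> 'rV[R]_7 -> 'rV[R]_7 -> R).
Implicit Types (cross : M -> 'rV[R]_7 -> 'rV[R]_7 -> 'rV[R]_7).
Implicit Types (nabla : (M -> 'rV[R]_7) -> M -> 'rV[R]_7 -> 'rV[R]_7).
Implicit Types (xi : M -> 'rV[R]_7 -> 'M[R]_7) (T : M -> 'M[R]_7).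

(* A frame on U: e q i is the value at q of the i-th field.  The sums i + 1
   and i + 3 are those of the ring 'I_7 of integers mod 7. *)
Definition cayley_frame g phi (U : set M) (e : M -> 'I_7 -> 'rV[R]_7) : Prop :=
  [/\ forall i, smooth_field U (e^~ i),
      forall q, U q -> orthonormal_basis g q (e q)
    & forall q, U q -> forall u v w,
        phi q u v w = \sum_(i : 'I_7)
          wedge3 (dual_basis (e q) i) (dual_basis (e q) (i + 1))
                 (dual_basis (e q) (i + 3)) u v w].

Definition g2_structure g phi : Prop :=
  forall p, exists (U : set M) (e : M -> 'I_7 -> 'rV[R]_7),
    [/\ open U, U p & cayley_frame g phi U e].

Definition cross_product g phi cross : Prop :=
  forall p u v w, dot g p (cross p u v) w = phi p u v w.

Definition in_g2 g cross p a : Prop :=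
  skew_endo g p a /\
  forall u v, cross p u v *m a = cross p (u *m a) v + cross p u (v *m a).

(* orthogonal complement of g_2 in so(T_pM) *)
Definition in_g2_perp g cross p a : Prop :=
  skew_endo g p a /\ forall b, in_g2 g cross p b -> dot_endo g p a b = 0.

Definition parallel_form phi nabla : Prop :=
  forall (U : set M) X Y Z, open U ->
  smooth_field U X -> smooth_field U Y -> smooth_field U Z ->
  forall p v, U p ->
  tdiff (fun q => phi q (X q) (Y q) (Z q)) p v =
    phi p (nabla X p v) (Y p) (Z p) + phi p (X p) (nabla Y p v) (Z p)
    + phi p (X p) (Y p) (nabla Z p v).

(* nablaG is the minimal G_2-connection and xi_v = nablaG_v - nabla_v is the
   endomorphism y |-> y *m xi p v of T_pM. *)
Definition minimal_connection g phi cross nabla nablaG xi : Prop :=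
  [/\ is_connection nablaG,
      metric_connection g nablaG /\ parallel_form phi nablaG,
      forall (U : set M) Y, open U -> smooth_field U Y ->
        forall p v, U p -> Y p *m xi p v = nablaG Y p v - nabla Y p v
    & forall p v, in_g2_perp g cross p (xi p v)].

(* xi_X Y = Y x T(X) *)
Definition torsion_endo cross xi T : Prop :=
  forall p v y, y *m xi p v = cross p y (v *m T p).

(* a1 is the pure trace part of a, a3 its trace-free symmetric part, a2 and a4
   the components of its skew part in g_2 and in the complement of g_2. *)
Definition g2_components g cross p a (a1 a2 a3 a4 : 'M[R]_7) : Prop :=
  [/\ a = a1 + a2 + a3 + a4,
      a1 = (7%:R^-1 * \tr a)%:M,
      in_g2 g cross p a2,
      sym_endo g p a3 /\ \tr a3 = 0
    & in_g2_perp g cross p a4].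

(* ||xi_(k)||^2 at p, for the orthonormal basis b of T_pM, where
   (xi_(k))_X Y = Y x T_(k)(X) and Tk = T_(k) at p *)
Definition sqnorm_xi g cross p (b : 'I_7 -> 'rV[R]_7) (Tk : 'M[R]_7) : R :=
  \sum_(i < 7) \sum_(j < 7)
    dot g p (cross p (b j) (b i *m Tk)) (cross p (b j) (b i *m Tk)).

(* sum_i xi_{b_i} b_i at p *)
Definition trace_xi xi p (b : 'I_7 -> 'rV[R]_7) : 'rV[R]_7 :=
  \sum_(i < 7) b i *m xi p (b i).

End G2Structure.

(* Main.v *)
Require Import Defs.
From HB Require Import structures.
From mathcomp Require Import all_boot all_order all_algebra.
From mathcomp Require Import all_classical all_reals all_analysis.
From mathcomp Require Import ring lra.

Set Implicit Arguments.
Unset Strict Implicit.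
Unset Printing Implicit Defensive.

Import Order.TTheory GRing.Theory Num.Theory.
Import numFieldNormedType.Exports.

Local Open Scope classical_set_scope.
Local Open Scope ring_scope.

(** In a local Cayley frame the form phi has the constant components eps, and
    nabla = nablaG - xi, where the connection matrices of nablaG take values in
    g_2 and xi is a combination of cross products, with coefficients the
    torsion matrix t.

    The scalar curvature is a contraction of the Riemann tensor with phi in both
    pairs of indices (curvature_contraction): the contraction of phi with itself
    is a combination of Kronecker symbols and of the 4-form psi, and the first
    Bianchi identity kills the psi part. In the second pair of indices the
    contraction with phi is the projection from so(7) onto the complement of
    g_2. It annihilates the curvature of nablaG, so that only first derivatives
    of t and products of connection matrices remain (curvature_frame,
    conn_coef_contr_diff). The derivatives of t form the divergence of the field
    \sum_i xi_{e_i} e_i, with coefficient -6. The matrices of nablaG only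
    contribute what turns the frame derivative into a covariant divergence, by
    equivariance of the cross product under g_2 (quadB).

    What is left is quadratic in t, and an identity between integer tensors
    (eps_quad) evaluates it to 9 ((tr t)^2 - |t|^2 + |w|^2), where w is the
    contraction of t with phi (quadratic_identity). Finally |xi_(k)|^2 =
    6 |t_(k)|^2, and these three invariants are combinations of the norms of the
    four components of t (components_norm).

    On the analytic side everything is computed with coordinate fields, which
    commute (lie_bracket_coord); this, and the skew-symmetry of the curvature,
    rest on the symmetry of second derivatives (Schwarz). *)

(** * Differential calculus in normed spaces *)

Section Calculus.
Context {R : realType}.

Section NearEq.
Context {V W : normedModType R}.
Implicit Types (f g : V -> W) (x v : V).

(** The little-o expansion that characterizes the differential only
    sees the germ of the function. *)
Lemma near_eq_differentiable f g x :
  (\near x, f x = g x) -> differentiable f x ->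
  differentiable g x /\ 'd g x = 'd f x :> (V -> W).
Proof.
move=> fg df.
have fgx : f x = g x by apply: (nbhs_singleton fg).
have H : g \o shift x = cst (g x) + 'd f x +o_ 0 id.
  apply/eqaddoP => e e0.
  have /eqaddoP/(_ e e0) dfe := diff_locally df.
  have fg0 : \forall h \near (0 : V), f (h + x) = g (h + x).
    by move: fg; rewrite (near_shift 0 x) subr0.
  near=> h => /=; rewrite -[_ h]/(g (h + x) - (g x + 'd f x h)) -fgx.
  have <- : f (h + x) = g (h + x) by near: h.
  by near: h.
have E : 'd g x = 'd f x :> (V -> W).
  by apply: diff_unique H; apply: diff_continuous.
split=> //; apply/diff_locallyP; split; first by rewrite E; apply: diff_continuous.
by rewrite E.
Unshelve. all: by end_near. Qed.

Lemma open_near_eq (U : set V) f g x :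
  open U -> U x -> (forall y, U y -> f y = g y) -> \near x, f x = g x.
Proof. by move=> oU Ux fg; apply: filterS fg _; exact: open_nbhs_nbhs. Qed.

Lemma open_eq_diff (U : set V) f g x :
  open U -> U x -> (forall y, U y -> f y = g y) -> differentiable f x ->
  differentiable g x /\ (forall v, 'd g x v = 'd f x v).
Proof.
move=> oU Ux fg df; have [dg E] := near_eq_differentiable (open_near_eq oU Ux fg) df.
by split=> [|v]; [exact: dg | rewrite E].
Qed.

Lemma diffD_at f g x v : differentiable f x -> differentiable g x ->
  'd (fun y => f y + g y) x v = 'd f x v + 'd g x v.
Proof. by move=> df dg; exact: (f_equal (fun h : V -> W => h v) (diffD df dg)). Qed.

Lemma eq_diff_at f x y v : x = y -> 'd f x v = 'd f y v.
Proof. by move=> ->. Qed.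

Lemma diff_comp_at (V' : normedModType R) (k : V' -> V) f (x v : V') :
  differentiable k x -> differentiable f (k x) ->
  'd (f \o k) x v = 'd f (k x) ('d k x v).
Proof. by move=> dk df;
  exact: (f_equal (fun h : V' -> W => h v) (diff_comp dk df)). Qed.

End NearEq.

Section CkOn.
Context {V : normedModType R}.

Lemma Ck_on_eq (W : normedModType R) k (U : set V) (f g : V -> W) :
  open U -> (forall y, U y -> f y = g y) -> Ck_on k U f -> Ck_on k U g.
Proof.
move=> oU; elim: k f g => [|k IH] f g fg /=.
  move=> cf x Ux; have fgx := fg x Ux.
  have : \near x, f x = g x := open_near_eq oU Ux fg.
  move=> h; rewrite /prop_for /continuous_at -fgx.
  by apply: cvg_trans (cf x Ux); apply: near_eq_cvg.
move=> [df cf]; split=> [x Ux|v].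
  by case: (open_eq_diff oU Ux fg (df x Ux)).
by apply: IH (cf v) => x Ux; case: (open_eq_diff oU Ux fg (df x Ux)) => _ E; exact/esym.
Qed.

Lemma Ck_on_sub (W : normedModType R) k (U U' : set V) (f : V -> W) :
  U' `<=` U -> Ck_on k U f -> Ck_on k U' f.
Proof.
move=> sU; elim: k f => [|k IH] f /=; first by move=> cf x /sU; exact: cf.
by move=> [df cf]; split=> [x /sU|v]; [exact: df | exact: IH].
Qed.

Lemma Ck_onS (W : normedModType R) k (U : set V) (f : V -> W) :
  Ck_on k.+1 U f -> Ck_on k U f.
Proof.
elim: k f => [|k IH] f /= [df cf]; last by split=> // v; exact: IH.
by move=> x Ux; apply: differentiable_continuous; exact: df.
Qed.

Lemma Ck_on_cst (W : normedModType R) k (U : set V) (a : W) :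
  Ck_on k U (fun=> a).
Proof.
elim: k a => [|k IH] a /=; first by move=> x _; apply: cst_continuous.
split=> [x _|v]; first exact: differentiable_cst.
rewrite (_ : (fun x => _) = fun=> 0) //.
by apply/funext => x; rewrite (_ : (fun=> a) = cst a)// diff_cst.
Qed.

Lemma Ck_onD (W : normedModType R) k (U : set V) (f g : V -> W) :
  open U -> Ck_on k U f -> Ck_on k U g -> Ck_on k U (fun x => f x + g x).
Proof.
move=> oU; elim: k f g => [|k IH] f g /=.
  by move=> cf cg x Ux; apply: continuousD; [exact: cf | exact: cg].
move=> [df cf] [dg cg]; split=> [x Ux|v].
  by apply: differentiableD; [exact: df | exact: dg].
apply: Ck_on_eq (IH _ _ (cf v) (cg v)) => // x Ux.
exact: esym (diffD_at v (df x Ux) (dg x Ux)).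
Qed.

Lemma Ck_on_lin (W W' : normedModType R) k (U : set V) (L : {linear W -> W'})
    (f : V -> W) :
  open U -> continuous L -> Ck_on k U f -> Ck_on k U (fun x => L (f x)).
Proof.
move=> oU cL; elim: k f => [|k IH] f /=.
  by move=> cf x Ux; apply: continuous_comp; [exact: cf | exact: cL].
move=> [df cf]; split=> [x Ux|v].
  by apply: (differentiable_comp (df x Ux)); exact: linear_differentiable.
apply: Ck_on_eq (IH _ (cf v)) => // x Ux.
have dL := @linear_differentiable _ _ _ L (f x) cL.
by rewrite -[fun x => L (f x)]/(L \o f) (diff_comp (df x Ux) dL) /= diff_lin.
Qed.

Lemma Ck_onN (W : normedModType R) k (U : set V) (f : V -> W) :
  open U -> Ck_on k U f -> Ck_on k U (fun x => - f x).
Proof.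
move=> oU; elim: k f => [|k IH] f /=.
  by move=> cf x Ux; apply: continuousN; exact: cf.
move=> [df cf]; split=> [x Ux|v]; first by apply: differentiableN; exact: df.
apply: Ck_on_eq (IH _ (cf v)) => // x Ux.
by rewrite -[fun x => - f x]/(- f) diffN //; exact: df.
Qed.

Lemma Ck_on_sum (W : normedModType R) (I : Type) (r : seq I) k (U : set V)
    (f : I -> V -> W) :
  open U -> (forall i, Ck_on k U (f i)) -> Ck_on k U (fun x => \sum_(i <- r) f i x).
Proof.
move=> oU cf; elim: r => [|i r IH].
  by rewrite (_ : (fun x => _) = fun=> 0); [exact: Ck_on_cst | apply/funext => x;
    rewrite big_nil].
rewrite (_ : (fun x => _) = fun x => f i x + \sum_(j <- r) f j x).
  exact: Ck_onD.
by apply/funext => x; rewrite big_cons.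
Qed.

(** Leibniz rule for a scalar function times a vector-valued one, from the
    differential of the bilinear map (a, w) |-> a *: w. *)
Lemma diff_scale (W : normedModType R) (k : V -> R) (f : V -> W) x :
  differentiable k x -> differentiable f x ->
  differentiable (fun y => k y *: f y) x /\
  forall v, 'd (fun y => k y *: f y) x v = k x *: 'd f x v + 'd k x v *: f x.
Proof.
move=> dk df.
have bl : bilinear_for
    (GRing.Scale.Law.clone _ _ *:%R _) (GRing.Scale.Law.clone _ _ *:%R _)
    (fun (a : R) (w : W) => a *: w).
  split=> [u' a x' y|u a x' y] /=.
  - by rewrite scalerDl -scalerA.
  - by rewrite scalerDr !scalerA mulrC.
pose blM := bilinear_isBilinear.Build R R W W _ _ (fun (a : R) (w : W) => a *: w) bl.
pose B : {bilinear R -> W -> W} := HB.pack (fun (a : R) (w : W) => a *: w) blM.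
have cB : continuous (fun p : R * W => B p.1 p.2) by move=> p; exact: scale_continuous.
pose h := fun y => (k y, f y).
have dh : differentiable h x by exact: differentiable_pair.
have E : (fun y => k y *: f y) = (fun p : R * W => B p.1 p.2) \o h by [].
have dB := differentiable_bilin (h x) cB.
rewrite E; split; first exact: differentiable_comp.
move=> v; rewrite (diff_comp dh dB) -[LHS]/('d (fun p : R * W => B p.1 p.2) (h x) ('d
  h x v)).
by rewrite (diff_bilin (h x) cB) /h (diff_pair dk df).
Qed.

Lemma Ck_onZ (W : normedModType R) n (U : set V) (k : V -> R) (f : V -> W) :
  open U -> Ck_on n U k -> Ck_on n U f -> Ck_on n U (fun x => k x *: f x).
Proof.
move=> oU; elim: n k f => [|n IH] k f.
  by move=> cf cg x Ux; apply: continuousZ; [exact: cf | exact: cg].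
move=> Ck Cf; have [dk ck] := Ck; have [df cf] := Cf; split=> [x Ux|v].
  by case: (diff_scale (dk x Ux) (df x Ux)).
have := Ck_onD oU (IH _ _ (Ck_onS Ck) (cf v)) (IH _ _ (ck v) (Ck_onS Cf)).
by apply: Ck_on_eq => // x Ux; case: (diff_scale (dk x Ux) (df x Ux)) => _ E;
  exact/esym.
Qed.

End CkOn.

Lemma linear_row_sum (W : lmodType R) m (L : {linear 'rV[R]_m -> W}) w :
  L w = \sum_i w 0 i *: L (delta_mx 0 i).
Proof.
by rewrite [in LHS](row_sum_delta w) linear_sum; apply: eq_bigr => i _; rewrite linearZ.
Qed.

Lemma Ck_on_coord (V : normedModType R) k (U : set V) n (f : V -> 'rV[R]_n) i :
  open U -> Ck_on k U f -> Ck_on k U (fun x => f x 0 i).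
Proof.
move=> oU Cf.
have @L : {linear 'rV[R]_n -> R}.
  by exists (fun N : 'rV[R]_n => N 0 i); do 2![eexists]; do ?[constructor];
     rewrite ?mxE// => ? *; rewrite ?mxE//; move=> ?; rewrite !mxE.
have cL : continuous L by exact: coord_continuous.
exact: (@Ck_on_lin V _ _ k U L f oU cL Cf).
Qed.

(** Induction on k: by the chain rule the derivative of f \o g along v is a
    combination of the compositions of g with the partial derivatives of f,
    whose coefficients are the coordinates of the derivative of g along v. *)
Lemma Ck_on_comp (V W : normedModType R) m k (U : set V) (U' : set 'rV[R]_m)
    (g : V -> 'rV[R]_m) (f : 'rV[R]_m -> W) :
  open U -> (forall x, U x -> U' (g x)) ->
  Ck_on k U g -> Ck_on k U' f -> Ck_on k U (f \o g).
Proof.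
move=> oU gU; elim: k f g gU => [|k IH] f g gU.
  move=> /= cg cf x Ux; have cfx := cf _ (gU _ Ux).
  by apply: continuous_comp; [exact: cg | exact: cfx].
move=> Cg Cf; have [dg cg] := Cg; have [df cf] := Cf; split=> [x Ux|v].
  exact: differentiable_comp (dg x Ux) (df (g x) (gU x Ux)).
have H : Ck_on k U (fun x => \sum_(i < m)
    ('d g x v) 0 i *: ((fun y => 'd f y (delta_mx 0 i)) \o g) x).
  apply: Ck_on_sum => // i; apply: Ck_onZ => //;
    first exact: (@Ck_on_coord V k U m (fun x => 'd g x v) i oU (cg v)).

  exact: IH gU (Ck_onS Cg) (cf (delta_mx 0 i)).
apply: Ck_on_eq H => // x Ux.
apply: etrans (esym (diff_comp_at v (dg x Ux) (df _ (gU _ Ux)))).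
exact: esym (linear_row_sum ('d f (g x)) ('d g x v)).
Qed.

Section Schwarz.
Context {V : normedModType R}.

Lemma is_derive_line (f : V -> R) (y v : V) (s : R) :
  differentiable f (y + s *: v) ->
  is_derive s 1 (fun s : R => f (y + s *: v)) ('d f (y + s *: v) v).
Proof.
move=> df.
have dl : is_diff s (fun s : R => y + s *: v) (fun s => s *: v).
  have -> : (fun s : R => y + s *: v) = cst y + ( *:%R ^~ v) by [].
  apply: (is_diff_eq (is_diffD (is_diff_cst y s) (is_diff_scalel s v))).
  by rewrite add0r.
have dfl : differentiable (f \o (fun s : R => y + s *: v)) s.
  by apply: differentiable_comp.
split; first exact: diff_derivable.
by rewrite deriveE // diff_comp //= diff_val scale1r.
Qed.

(** The mean value theorem applied twice, first along u, then along v. *)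
Lemma second_difference (U : set V) (f : V -> R) (x u v : V) (h : R) :
  0 < h -> Ck_on 2 U f ->
  (forall s r, 0 <= s <= h -> 0 <= r <= h -> U (x + s *: u + r *: v)) ->
  exists s r, [/\ 0 <= s <= h, 0 <= r <= h &
    f (x + h *: u + h *: v) - f (x + h *: u) - f (x + h *: v) + f x =
    'd (fun z => 'd f z u) (x + s *: u + r *: v) v * h * h].
Proof.
move=> h0 Cf Uh; have [df Cdf] := Cf; have [ddf _] := Cdf u.
have h0h : 0 <= h <= h by rewrite (ltW h0) lexx.
have h00 : 0 <= (0 : R) <= h by rewrite (ltW h0) lexx.
pose g s := f (x + h *: v + s *: u) - f (x + s *: u).
have dg s : 0 <= s <= h -> is_derive s 1 g
   ('d f (x + h *: v + s *: u) u - 'd f (x + s *: u) u).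
  move=> sh; apply: is_deriveB; apply: is_derive_line.
    by apply: df; rewrite addrAC; exact: Uh.
  by apply: df; have := Uh s 0 sh h00; rewrite scale0r addr0.
have [||s] := @MVT R g (fun s => 'd f (x + h *: v + s *: u) u - 'd f (x
  + s *: u) u) 0 h h0.
- by move=> s; rewrite in_itv /= => /andP[s0 sh]; apply: dg; rewrite !ltW.
- apply: derivable_within_continuous => s; rewrite in_itv /= => sh.
  by case: (dg s sh).
rewrite in_itv /= => /andP[s0 sh]; rewrite subr0 => gE.
have sh' : 0 <= s <= h by rewrite !ltW.
pose k r := 'd f (x + s *: u + r *: v) u.
have dk r : 0 <= r <= h -> is_derive r 1 k ('d (fun z => 'd f z u) (x + s *: u
  + r *: v) v).
  by move=> rh; apply: (@is_derive_line (fun z => 'd f z u)); apply: ddf; exact: Uh.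
have [||r] := @MVT R k (fun r => 'd (fun z => 'd f z u) (x + s *: u + r *: v) v) 0 h h0.
- by move=> r; rewrite in_itv /= => /andP[r0 rh]; apply: dk; rewrite !ltW.
- apply: derivable_within_continuous => r; rewrite in_itv /= => rh.
  by case: (dk r rh).
rewrite in_itv /= => /andP[r0 rh]; rewrite subr0 => kE.
exists s, r; split=> //; first by rewrite !ltW.
rewrite -kE /k scale0r addr0 [x + s *: u + h *: v]addrAC -gE /g scale0r !addr0.
by rewrite [x + h *: v + h *: u]addrAC opprB addrA addrAC.
Qed.

(** The second difference is symmetric in u and v, so both mixed derivatives
    take a common value, at two points that tend to x. *)
Lemma Schwarz (U : set V) (f : V -> R) (x u v : V) :
  open U -> U x -> Ck_on 2 U f ->
  'd (fun y => 'd f y v) x u = 'd (fun y => 'd f y u) x v.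
Proof.
move=> oU Ux Cf; have [df Cdf] := Cf.
have [_ /(_ u) ca] := Cdf v; have [_ /(_ v) cb] := Cdf u.
set a := (fun x => 'd (fun y => 'd f y v) x u) in ca.
set b := (fun x => 'd (fun y => 'd f y u) x v) in cb.
apply/eqP; rewrite -subr_eq0 -normr_eq0; apply/negPn/negP => ab0.
(* The two values differ by 2 e, but both functions stay within e of their
   value at x near x, and take a common value there. *)
pose e := `|a x - b x| / 2.
have e0 : 0 < e by rewrite divr_gt0 // lt_def ab0 normr_ge0.
have na : \forall y \near x, `|a x - a y| < e.
  by move/cvgrPdist_lt: (ca x Ux); apply.
have nb : \forall y \near x, `|b x - b y| < e.
  by move/cvgrPdist_lt: (cb x Ux); apply.
have nU : \forall y \near x, U y by exact: open_nbhs_nbhs.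
have : \forall y \near x, [/\ `|a x - a y| < e, `|b x - b y| < e & U y].
  by near=> y; split; near: y.
move=> /nbhs_ballP[d /= d0 H].
(* Small enough for the parallelogram with sides h u and h v to lie in the
   ball; the term 1 avoids a division by zero. *)
pose h := d / (1 + `|u| + `|v|) / 2.
have n0 : 0 < 1 + `|u| + `|v| by rewrite -addrA ltr_wpDr // addr_ge0.
have h0 : 0 < h by rewrite !divr_gt0.
have Hh s r : 0 <= s <= h -> 0 <= r <= h ->
    [/\ `|a x - a (x + s *: u + r *: v)| < e, `|b x - b (x + s *: u + r *: v)| < e
      & U (x + s *: u + r *: v)].
  move=> /andP[s0 sh] /andP[r0 rh]; apply: H.
  rewrite -ball_normE /= -addrA opprD addrA subrr sub0r normrN.
  apply: le_lt_trans (ler_normD _ _) _; rewrite !normrZ !ger0_norm //.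
  apply: (@le_lt_trans _ _ (h * (1 + `|u| + `|v|))).
    rewrite !mulrDr -addrA ler_wpDl ?mulr1 ?(ltW h0)//.
    by apply: lerD; apply: ler_wpM2r.
  by rewrite /h mulrAC divfK ?gt_eqF // ltr_pdivrMr // ltr_pMr // ltr1n.
have [s [r [hs hr E1]]] := second_difference (u := u) (v := v) h0 Cf
  (fun s r hs hr => let: And3 _ _ K := Hh s r hs hr in K).
have [|s' [r' [hs' hr' E2]]] := @second_difference U f x v u h h0 Cf.
  by move=> s' r' hs' hr'; rewrite addrAC; case: (Hh r' s' hr' hs').
have E : b (x + s *: u + r *: v) = a (x + r' *: u + s' *: v).
  have /mulIf := lt0r_neq0 h0; apply; have /mulIf := lt0r_neq0 h0; apply.
  rewrite -E1 [x + r' *: u + s' *: v]addrAC -E2 [x + h *: v + h *: u]addrAC.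
  by rewrite -!addrA; congr (_ + _); rewrite !addrA; congr (_ + _); rewrite addrC.
have [_ Hb _] := Hh _ _ hs hr; have [Ha _ _] := Hh _ _ hr' hs'.
suff : `|a x - b x| < `|a x - b x| by rewrite ltxx.
rewrite {2}[`|_|]splitr -/e.
rewrite -(subrKA (a (x + r' *: u + s' *: v))) -{2}E.
apply: le_lt_trans (ler_normD _ _) _; apply: ltrD => //.
by rewrite distrC.
Unshelve. all: by end_near. Qed.

Lemma diff_coord m (f : V -> 'rV[R]_m) x v i : differentiable f x ->
  'd (fun y => f y 0 i) x v = ('d f x v) 0 i.
Proof.
move=> df.
have @L : {linear 'rV[R]_m -> R}.
  by exists (fun N : 'rV[R]_m => N 0 i); do 2![eexists]; do ?[constructor];
     rewrite ?mxE// => ? *; rewrite ?mxE//; move=> ?; rewrite !mxE.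
have cL : continuous L by exact: coord_continuous.
have dL := @linear_differentiable _ _ _ L (f x) cL.
have dLE : 'd L (f x) = L :> (_ -> _) := diff_lin (f x) cL.
have dcE := diff_comp df dL.
have := f_equal (fun h : V -> R => h v) dcE; rewrite -/(comp _ _) => E.
apply: etrans E _; exact: (f_equal (fun h : 'rV[R]_m -> R => h ('d f x v)) dLE).
Qed.

Lemma Schwarz_row m (U : set V) (f : V -> 'rV[R]_m) (x u v : V) :
  open U -> U x -> Ck_on 2 U f ->
  'd (fun y => 'd f y v) x u = 'd (fun y => 'd f y u) x v.
Proof.
move=> oU Ux Cf; have [df Cdf] := Cf; apply/rowP => i.
have sw v' u' : ('d (fun y => 'd f y v') x u') 0 i =
    'd (fun y => 'd (fun y => f y 0 i) y v') x u'.
  have [ddf _] := Cdf v'; rewrite -diff_coord; last exact: ddf.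
  have dE y : U y -> 'd f y v' 0 i = 'd (fun y => f y 0 i) y v'.
    by move=> Uy; rewrite diff_coord //; exact: df.
  have dd : differentiable (fun y => 'd f y v' 0 i) x.
    by have [+ _] := @Ck_on_coord V 1 U m (fun y => 'd f y v') i oU (Cdf v'); apply.
  by have [_ E] := open_eq_diff oU Ux dE dd; exact: esym (E u').
by rewrite !sw; apply: (Schwarz _ _ oU Ux); exact: (@Ck_on_coord V 2 U m f i oU Cf).
Qed.

End Schwarz.
End Calculus.

(** * Smooth maps and vector fields *)

Section Manifold.
Context {R : realType} {n : nat} {M : manifold R n}.
Implicit Types (p q : M) (u v w : 'rV[R]_n) (X Y Z : M -> 'rV[R]_n).
Implicit Types (U : set M) (c : chart R n M).

Lemma open_chart_pull c U : open U -> open (chart_cod c `&` chart_inv c @^-1` U).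
Proof.
move=> oU; rewrite openE => x [cx Ux]; apply: filterI.
  by apply: open_nbhs_nbhs; split=> //; exact: chart_cod_open.
by apply: (chart_inv_continuous cx); exact: open_nbhs_nbhs.
Qed.

Lemma chart_pull_mem c U q : chart_dom c q -> U q ->
  (chart_cod c `&` chart_inv c @^-1` U) (c q).
Proof. by move=> cq Uq; split; [exact: chart_map_cod | rewrite /= chart_mapK]. Qed.

(** This is the compatibility of the charts of the atlas. *)
Lemma chart_smooth c : atlas c -> smooth_map (chart_dom c) c.
Proof. by move=> ac c' ac'; exact: atlas_compatible. Qed.

Lemma smooth_map_sub (W : normedModType R) U U' (f : M -> W) :
  U' `<=` U -> smooth_map U f -> smooth_map U' f.
Proof.
by move=> sU sf c ac k; apply: Ck_on_sub (sf c ac k) => x [cx /sU]; split.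
Qed.

Lemma smooth_field_sub U U' X :
  U' `<=` U -> smooth_field U X -> smooth_field U' X.
Proof.
by move=> sU sf c ac k; apply: Ck_on_sub (sf c ac k) => x [cx /sU]; split.
Qed.

Lemma smooth_map_eq (W : normedModType R) U (f h : M -> W) :
  open U -> (forall q, U q -> f q = h q) -> smooth_map U f -> smooth_map U h.
Proof.
move=> oU fh sf c ac k; apply: Ck_on_eq (sf c ac k); first exact: open_chart_pull.
by move=> y [cy Uy]; exact: fh.
Qed.

Lemma smooth_map_diff (W : normedModType R) U (f : M -> W) c q :
  smooth_map U f -> atlas c -> chart_dom c q -> U q ->
  differentiable (f \o chart_inv c) (c q).
Proof.
by move=> sf ac cq Uq; have [+ _] := sf c ac 1%N; apply; exact: chart_pull_mem.
Qed.

Lemma smooth_map_cst (W : normedModType R) U (a : W) : smooth_map U (fun=> a).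
Proof. by move=> c ac k; exact: Ck_on_cst. Qed.

Lemma smooth_mapD (W : normedModType R) U (f h : M -> W) :
  open U -> smooth_map U f -> smooth_map U h -> smooth_map U (fun q => f q + h q).
Proof.
move=> oU sf sh c ac k.
by apply: Ck_onD; [exact: open_chart_pull | exact: sf | exact: sh].
Qed.

Lemma smooth_map_sum (W : normedModType R) (I : Type) (r : seq I) U (f : I -> M -> W) :
  open U -> (forall i, smooth_map U (f i)) -> smooth_map U (fun q => \sum_(i <- r) f i
    q).
Proof.
move=> oU sf c ac k.
by apply: (@Ck_on_sum _ _ _ _ r k _ (fun i => f i \o chart_inv c));
  [exact: open_chart_pull | move=> i; exact: sf].
Qed.

Lemma smooth_mapM U (f h : M -> R) :
  open U -> smooth_map U f -> smooth_map U h -> smooth_map U (fun q => f q * h q).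
Proof.
move=> oU sf sh c ac k.
by apply: (@Ck_onZ _ _ R^o); [exact: open_chart_pull | exact: sf | exact: sh].
Qed.

Section Tdiff.
Context {W : normedModType R}.
Implicit Types f h : M -> W.

Lemma tdiff_eq U f h p v : open U -> U p -> smooth_map U f ->
  (forall q, U q -> f q = h q) -> tdiff h p v = tdiff f p v.
Proof.
move=> oU Up sf fh; have df := smooth_map_diff sf (chart_at_atlas p) (chart_at_dom p)
  Up.
have fh' y : (chart_cod (chart_at p) `&` chart_inv (chart_at p) @^-1` U) y ->
  (f \o chart_inv (chart_at p)) y = (h \o chart_inv (chart_at p)) y.
  by move=> [_ Uy]; exact: fh.
by have [_ E] := open_eq_diff (open_chart_pull (c := chart_at p) oU)
  (chart_pull_mem (chart_at_dom p) Up) fh' df; exact: E.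
Qed.

Lemma tdiff_cst (a : W) p v : tdiff (fun=> a) p v = 0.
Proof. by rewrite /tdiff (_ : _ \o _ = cst a) // diff_cst. Qed.

Lemma tdiffD U f h p v : U p -> smooth_map U f -> smooth_map U h ->
  tdiff (fun q => f q + h q) p v = tdiff f p v + tdiff h p v.
Proof.
move=> Up sf sh.
have df := smooth_map_diff sf (chart_at_atlas p) (chart_at_dom p) Up.
have dh := smooth_map_diff sh (chart_at_atlas p) (chart_at_dom p) Up.
exact: diffD_at v df dh.
Qed.

Lemma tdiff_sum (I : Type) (r : seq I) U (f : I -> M -> W) p v :
  open U -> U p -> (forall i, smooth_map U (f i)) ->
  tdiff (fun q => \sum_(i <- r) f i q) p v = \sum_(i <- r) tdiff (f i) p v.
Proof.
move=> oU Up sf; elim: r => [|i r IH].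
  rewrite big_nil -[RHS](tdiff_cst 0 p v).
  by congr (tdiff _ p v); apply/funext => q; rewrite big_nil.
rewrite big_cons -IH.
rewrite (_ : (fun q => _) = fun q => f i q + \sum_(j <- r) f j q).
  by apply: (tdiffD _ Up (sf i)); exact: smooth_map_sum.
by apply/funext => q; rewrite big_cons.
Qed.

(** Chain rule: a derivative computed in the reference chart at q can be
    computed in any chart c, once the components of the vector are converted
    from c to the reference chart. *)
Lemma tdiff_chart c U f q v : atlas c -> chart_dom c q -> open U -> U q ->
  smooth_map U f ->
  tdiff f q ('d (chart_at q \o chart_inv c) (c q) v) = 'd (f \o chart_inv c) (c q) v.
Proof.
move=> ac cq oU Uq sf; rewrite /tdiff.
have df := smooth_map_diff sf (chart_at_atlas q) (chart_at_dom q) Uq.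
have dc := smooth_map_diff (chart_smooth (chart_at_atlas q)) ac cq (chart_at_dom q).
have E : (chart_at q \o chart_inv c) (c q) = chart_at q q by rewrite /= chart_mapK.
rewrite -E in df.
have dfc := differentiable_comp dc df.
have fh' y : (chart_cod c `&` chart_inv c @^-1` chart_dom (chart_at q)) y ->
  ((f \o chart_inv (chart_at q)) \o (chart_at q \o chart_inv c)) y = (f \o chart_inv
    c) y.
  by move=> [cy qy]; rewrite /= chart_mapK.
have [_ E'] := open_eq_diff (open_chart_pull (c := c) (chart_dom_open (chart_at q)))
  (chart_pull_mem cq (chart_at_dom q)) fh' dfc.
apply: etrans (esym (E' v)).
apply: etrans (esym (diff_comp_at v dc df)).
exact: eq_diff_at (esym E).
Qed.

(** On the whole domain of the chart at p, the fields coord_field p v act on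
    functions as directional derivatives in that single chart. This is what
    reduces second derivatives on the manifold to those of Schwarz. *)
Lemma tdiff_coord U f p q v : open U -> U q -> smooth_map U f ->
  chart_dom (chart_at p) q ->
  tdiff f q (coord_field p v q) = 'd (f \o chart_inv (chart_at p)) (chart_at p q) v.
Proof. by move=> oU Uq sf pq; exact: tdiff_chart (chart_at_atlas p) pq oU Uq sf. Qed.

Lemma smooth_map_diff_chart c U f v : atlas c -> open U -> smooth_map U f ->
  smooth_map (U `&` chart_dom c) (fun q => 'd (f \o chart_inv c) (c q) v).
Proof.
move=> ac oU sf c' ac' k.
have [_ /(_ v) Cf] := sf c ac k.+1.
have Cc := chart_smooth ac ac' k.
have := @Ck_on_comp R _ W n k (chart_cod c' `&` chart_inv c' @^-1` (U `&` chart_dom c))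
   _ _ _ _ _ (Ck_on_sub _ Cc) Cf; apply.
- by apply/open_chart_pull/openI => //; exact: chart_dom_open.
- by move=> x [cx [Ux dx]]; exact: chart_pull_mem.
- by move=> x [cx [Ux dx]]; split.
Qed.

Lemma smooth_map_tdiff_coord U f p v : open U -> smooth_map U f ->
  smooth_map (U `&` chart_dom (chart_at p)) (fun q => tdiff f q (coord_field p v q)).
Proof.
move=> oU sf; have op := chart_dom_open (chart_at p).
apply: smooth_map_eq (smooth_map_diff_chart v (chart_at_atlas p) oU sf).
  exact: openI.
by move=> q [Uq dq]; exact: esym (tdiff_coord _ oU Uq sf dq).
Qed.

Lemma tdiff2_coord U f p q u v : open U -> U q -> smooth_map U f ->
  chart_dom (chart_at p) q ->
  tdiff (fun q => tdiff f q (coord_field p v q)) q (coord_field p u q) =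
  'd (fun y => 'd (f \o chart_inv (chart_at p)) y v) (chart_at p q) u.
Proof.
move=> oU Uq sf dq; have op := chart_dom_open (chart_at p).
have sdf := smooth_map_tdiff_coord p v oU sf.
apply: etrans (tdiff_coord _ (openI oU op) (conj Uq dq) sdf dq) _.
have df := smooth_map_diff sdf (chart_at_atlas p) dq (conj Uq dq).
have fh' y : (chart_cod (chart_at p) `&` chart_inv (chart_at p) @^-1` U) y ->
  ((fun q => tdiff f q (coord_field p v q)) \o chart_inv (chart_at p)) y =
  'd (f \o chart_inv (chart_at p)) y v.
  move=> [cy Uy]; apply: etrans (tdiff_coord _ oU Uy sf (chart_inv_dom cy)) _.
  exact: eq_diff_at (chart_invK cy).
have [_ E] := open_eq_diff (open_chart_pull (c := chart_at p) oU) (chart_pull_mem dq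
  Uq) fh' df.
exact: esym (E u).
Qed.

End Tdiff.

Lemma tdiffM U (f h : M -> R) p v : U p -> smooth_map U f -> smooth_map U h ->
  tdiff (fun q => f q * h q) p v = tdiff f p v * h p + f p * tdiff h p v.
Proof.
move=> Up sf sh.
have df := smooth_map_diff sf (chart_at_atlas p) (chart_at_dom p) Up.
have dh := smooth_map_diff sh (chart_at_atlas p) (chart_at_dom p) Up.
have := f_equal (fun k : 'rV[R]_n -> R => k v) (diffM df dh).
rewrite /= chart_mapK; last exact: chart_at_dom.
move=> E; apply: etrans E _; rewrite addrC; congr (_ + _); exact: mulrC.
Qed.

Lemma tdiff_commute U (f : M -> R) p q u v : open U -> U q -> smooth_map U f ->
  chart_dom (chart_at p) q ->
  tdiff (fun q => tdiff f q (coord_field p v q)) q (coord_field p u q) =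
  tdiff (fun q => tdiff f q (coord_field p u q)) q (coord_field p v q).
Proof.
move=> oU Uq sf dq; have E u' v' := tdiff2_coord u' v' oU Uq sf dq.
apply: etrans (E u v) _; apply: etrans (esym (E v u)).
apply: (@Schwarz _ _ (chart_cod (chart_at p) `&` chart_inv (chart_at p) @^-1` U)).
- exact: open_chart_pull.
- exact: chart_pull_mem.
- exact: sf _ (chart_at_atlas p) 2%N.
Qed.

Lemma coord_field_smooth p v : smooth_field (chart_dom (chart_at p)) (coord_field p v).
Proof.
move=> c ac; have op := chart_dom_open (chart_at p); have oc := chart_dom_open c.
have := smooth_map_tdiff_coord p v oc (chart_smooth ac).
move=> /(_ c ac) H k; apply: Ck_on_sub (H k) => x [cx dx]; split=> //; split=> //.
exact: chart_inv_dom.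
Qed.

Lemma coord_field_center p v : coord_field p v p = v.
Proof.
have di : is_diff (chart_at p p) (@id 'rV[R]_n) id := is_diff_id _.
have fh' y : chart_cod (chart_at p) y -> id y = (chart_at p \o chart_inv (chart_at p))
  y.
  by move=> cy; rewrite /= chart_invK.
have [_ E] := open_eq_diff (@chart_cod_open _ _ _ (chart_at p)) (chart_map_cod
  (chart_at_dom p)) fh' (@ex_diff _ _ _ _ _ _ _ di).
by apply: etrans (E v) _; rewrite diff_val.
Qed.

Lemma coord_fieldP p q a u v :
  coord_field p (a *: u + v) q = a *: coord_field p u q + coord_field p v q.
Proof. by rewrite /coord_field linearP. Qed.

(** The bracket at q is computed in the chart at q, in which coordinate
    fields of the chart at p are derivatives of the transition map; the two
    terms are its mixed second derivatives. *)
Lemma lie_bracket_coord p q u v : chart_dom (chart_at p) q ->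
  lie_bracket (coord_field p u) (coord_field p v) q = 0.
Proof.
move=> pq; have oq := chart_dom_open (chart_at q).
have E u' v' := tdiff2_coord u' v' oq (chart_at_dom q) (chart_smooth (chart_at_atlas
  q)) pq.
apply/eqP; rewrite subr_eq0; apply/eqP.
apply: etrans (E u v) _; apply: etrans (esym (E v u)).
apply: (@Schwarz_row _ _ _ (chart_cod (chart_at p) `&` chart_inv (chart_at p) @^-1`
  (chart_dom (chart_at q)))).
- exact: open_chart_pull.
- exact: chart_pull_mem pq (chart_at_dom q).
- exact: chart_smooth (chart_at_atlas q) _ (chart_at_atlas p) 2%N.
Qed.

Lemma smooth_field_eq U X Y :
  open U -> (forall q, U q -> X q = Y q) -> smooth_field U X -> smooth_field U Y.
Proof.
move=> oU XY sX c ac k; apply: Ck_on_eq (sX c ac k); first exact: open_chart_pull.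
by move=> y [cy Uy]; rewrite XY.
Qed.

Lemma smooth_fieldD U X Y : open U -> smooth_field U X -> smooth_field U Y ->
  smooth_field U (fun q => X q + Y q).
Proof.
move=> oU sX sY c ac k.
have := Ck_onD (open_chart_pull (c := c) oU) (sX c ac k) (sY c ac k).
by congr (Ck_on _ _ _); apply/funext => x; rewrite /tdiff linearD.
Qed.

Lemma smooth_fieldN U X : open U -> smooth_field U X -> smooth_field U (fun q => - X q).
Proof.
move=> oU sX c ac k; have := Ck_onN (open_chart_pull (c := c) oU) (sX c ac k).
by congr (Ck_on _ _ _); apply/funext => x; rewrite /tdiff linearN.
Qed.

Lemma smooth_fieldZ U (a : R) X : open U -> smooth_field U X ->
  smooth_field U (fun q => a *: X q).
Proof.
move=> oU sX c ac k.
have := Ck_onZ (open_chart_pull (c := c) oU) (Ck_on_cst (W := R) k _ a) (sX c ac k).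
by congr (Ck_on _ _ _); apply/funext => x; rewrite /tdiff linearZ.
Qed.

Lemma smooth_field0 U : smooth_field U (fun=> 0).
Proof.
move=> c ac k; have := @Ck_on_cst R 'rV_n 'rV_n k (chart_cod c `&` chart_inv c @^-1`
  U) 0.
by congr (Ck_on _ _ _); apply/funext => x; rewrite /tdiff linear0.
Qed.

Lemma smooth_field_sum (I : Type) (r : seq I) U (X : I -> M -> 'rV[R]_n) :
  open U -> (forall i, smooth_field U (X i)) -> smooth_field U (fun q => \sum_(i <- r)
    X i q).
Proof.
move=> oU sX; elim: r => [|i r IH].
  by rewrite (_ : (fun q => _) = fun=> 0); [exact: smooth_field0 | apply/funext => x;
    rewrite big_nil].
rewrite (_ : (fun q => _) = fun q => X i q + \sum_(j <- r) X j q);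
  first exact: smooth_fieldD.
by apply/funext => x; rewrite big_cons.
Qed.

End Manifold.

(** * Metrics, connections and curvature *)

Section Connections.
Context {R : realType} {n : nat} {M : manifold R n}.
Implicit Types (p q : M) (u v w : 'rV[R]_n) (X Y Z : M -> 'rV[R]_n).
Implicit Types (U : set M).

Section Dot.
Variable g : riemannian_metric M.

Lemma dotDl p u v w : dot g p (u + v) w = dot g p u w + dot g p v w.
Proof. by rewrite /dot !mulmxDl mxE. Qed.

Lemma dotZl p (a : R) u w : dot g p (a *: u) w = a * dot g p u w.
Proof. by rewrite /dot -!scalemxAl mxE. Qed.

Lemma dotC p u v : dot g p u v = dot g p v u.
Proof.
rewrite /dot; transitivity ((u *m gram g p *m v^T)^T 0 0); first by rewrite [RHS]mxE.
by rewrite !trmx_mul trmxK gram_sym mulmxA.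
Qed.

Lemma dotDr p u v w : dot g p w (u + v) = dot g p w u + dot g p w v.
Proof. by rewrite dotC dotDl !(dotC _ _ w). Qed.

Lemma dotNl p u w : dot g p (- u) w = - dot g p u w.
Proof. by rewrite -scaleN1r dotZl mulN1r. Qed.

Lemma dotNr p u w : dot g p w (- u) = - dot g p w u.
Proof. by rewrite dotC dotNl dotC. Qed.

Lemma dotBl p u v w : dot g p (u - v) w = dot g p u w - dot g p v w.
Proof. by rewrite dotDl dotNl. Qed.

Lemma dotBr p u v w : dot g p w (u - v) = dot g p w u - dot g p w v.
Proof. by rewrite dotDr dotNr. Qed.

Lemma dot0l p w : dot g p 0 w = 0.
Proof. by rewrite -(scale0r 0) dotZl mul0r. Qed.

Lemma dot_suml (I : Type) (r : seq I) p (f : I -> 'rV[R]_n) w :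
  dot g p (\sum_(i <- r) f i) w = \sum_(i <- r) dot g p (f i) w.
Proof.
by elim: r => [|i r IH]; rewrite ?big_nil ?dot0l // !big_cons dotDl IH.
Qed.

Lemma dot_ext p u v : (forall w, dot g p u w = dot g p v w) -> u = v.
Proof.
move=> uv; apply/eqP; rewrite -subr_eq0; apply/negPn/negP => /(gram_pos g p).
by rewrite -/(dot g p _ _) dotBl uv subrr ltxx.
Qed.

Lemma smooth_dot U X Y : open U -> smooth_field U X -> smooth_field U Y ->
  smooth_map U (fun q => dot g q (X q) (Y q)).
Proof. exact: gram_smooth. Qed.

Section Basis.
Variables (p : M) (b : 'I_n -> 'rV[R]_n).
Hypothesis ob : orthonormal_basis g p b.

Let E : 'M[R]_n := \matrix_i b i.

Lemma onb_mx : E *m gram g p *m E^T = 1%:M.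
Proof.
apply/matrixP => i j; rewrite !mxE.
transitivity (dot g p (b i) (b j)); last exact: ob.
rewrite /dot [in RHS]mxE; apply: eq_bigr => k _; rewrite !mxE; congr (_ * _).
by apply: eq_bigr => l _; rewrite !mxE.
Qed.

Lemma onb_unit : E \in unitmx.
Proof. by have [] := mulmx1_unit onb_mx; rewrite unitmx_mul => /andP[]. Qed.

Lemma gram_unit : gram g p \in unitmx.
Proof. by have [+ _] := mulmx1_unit onb_mx; rewrite unitmx_mul => /andP[]. Qed.

(** This converts contractions with the inverse metric into sums over an
    orthonormal basis. *)
Lemma onb_invmx_gram : invmx (gram g p) = E^T *m E.
Proof.
have H : E^T *m E *m gram g p = 1%:M.
  by apply: mulmx1C; rewrite mulmxA; apply: mulmx1C; rewrite mulmxA onb_mx.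
by have [_ Hu] := mulmx1_unit H; rewrite -[LHS]mul1mx -H mulmxK.
Qed.

Lemma onb_expand u : u = \sum_i dot g p u (b i) *: b i.
Proof.
have /(congr1 (mulmx u)) : gram g p *m (E^T *m E) = 1%:M.
  by rewrite -onb_invmx_gram mulmxV // gram_unit.
rewrite mulmx1 => {1}<-; rewrite !mulmxA.
apply/rowP => k; rewrite mxE summxE; apply: eq_bigr => i _.
rewrite !mxE; congr (_ * _); rewrite /dot mxE; apply: eq_bigr => l _.
by rewrite !mxE.
Qed.

Lemma onb_parseval u v : dot g p u v = \sum_i dot g p u (b i) * dot g p v (b i).
Proof.
rewrite {1}(onb_expand u) dot_suml; apply: eq_bigr => i _.
by rewrite dotZl (dotC p (b i)).
Qed.

Lemma onb_gram_sum i j : \sum_k b k 0 i * b k 0 j = invmx (gram g p) i j.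
Proof.
by rewrite onb_invmx_gram mxE; apply: eq_bigr => k _; rewrite !mxE.
Qed.

Lemma onb_trace (L : 'rV[R]_n -> 'rV[R]_n) : linear L ->
  \sum_k (L (delta_mx 0 k)) 0 k = \sum_i dot g p (L (b i)) (b i).
Proof.
move=> linL; pose LM := GRing.isLinear.Build _ _ _ _ _ linL.
pose L' : {linear 'rV[R]_n -> 'rV[R]_n} := HB.pack L LM.
have LE u : L u = u *m lin1_mx L' by rewrite mul_rV_lin1.
transitivity (\tr (lin1_mx L')).
  by apply: eq_bigr => k _; rewrite LE -rowE mxE.
have tE : \tr (lin1_mx L') = \tr (E *m lin1_mx L' *m gram g p *m E^T).
  rewrite mxtrace_mulC !mulmxA -onb_invmx_gram -mulmxA mxtrace_mulC -mulmxA.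
  by rewrite mulmxV ?mulmx1 // gram_unit.
rewrite tE; apply: eq_bigr => i _; rewrite /dot LE !mxE.
apply: eq_bigr => k _; rewrite !mxE; congr (_ * _); apply: eq_bigr => l _.
by rewrite !mxE; congr (_ * _); apply: eq_bigr => m _; rewrite !mxE.
Qed.

End Basis.
End Dot.

Section Connection.
Variables (nabla : (M -> 'rV[R]_n) -> M -> 'rV[R]_n -> 'rV[R]_n).
Hypothesis cnabla : is_connection nabla.

Lemma nabla_linear U Y p : open U -> smooth_field U Y -> U p -> linear (nabla Y p).
Proof. by move=> oU sY Up; have [+ _ _ _] := cnabla oU; apply. Qed.

Lemma nabla_smooth U X Y : open U -> smooth_field U X -> smooth_field U Y ->
  smooth_field U (fun q => nabla Y q (X q)).
Proof. by move=> oU sX sY; have [_ _ _ +] := cnabla oU; apply. Qed.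

Lemma nablaD U Y Z p v : open U -> smooth_field U Y -> smooth_field U Z -> U p ->
  nabla (fun q => Y q + Z q) p v = nabla Y p v + nabla Z p v.
Proof. by move=> oU sY sZ Up; have [_ + _ _] := cnabla oU; apply. Qed.

Lemma nablaZ U (a : R) Y p v : open U -> smooth_field U Y -> U p ->
  nabla (fun q => a *: Y q) p v = a *: nabla Y p v.
Proof.
move=> oU sY Up; have [_ _ L _] := cnabla oU.
have := L (fun=> a) Y (smooth_map_cst U (a : R)) sY p v Up.
by rewrite tdiff_cst scale0r add0r.
Qed.

(** The Leibniz rule applied to the indicator function of U, which is
    smooth on U: multiplying Y and Y' by it gives the same field. *)
Lemma nabla_local U Y Y' p v : open U -> smooth_field U Y -> smooth_field U Y' ->
  U p -> (forall q, U q -> Y q = Y' q) -> nabla Y p v = nabla Y' p v.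
Proof.
move=> oU sY sY' Up YY'; have [_ _ L _] := cnabla oU.
pose f q : R := if `[< U q >] then 1 else 0.
have f1 q : U q -> f q = 1 by move=> Uq; rewrite /f asboolT.
have sf : smooth_map U f.
  by apply: smooth_map_eq (smooth_map_cst U (1 : R)) => // q /f1.
have fp Z : smooth_field U Z -> nabla (fun q => f q *: Z q) p v = nabla Z p v.
  move=> sZ; rewrite (L _ _ sf sZ _ _ Up) f1 // scale1r.
  have -> : tdiff f p v = 0.
    rewrite -(tdiff_cst (1 : R) p v);
      apply: (tdiff_eq _ oU Up (smooth_map_cst U (1 : R))).
    by move=> q /f1.
  by rewrite scale0r add0r.
rewrite -fp // -(fp Y') //; congr (nabla _ _ _); apply/funext => q.
by rewrite /f; case: asboolP => [/YY' ->//|_]; rewrite !scale0r.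
Qed.

End Connection.

Section LeviCivita.
Variables (g : riemannian_metric M).
Variables (nabla : (M -> 'rV[R]_n) -> M -> 'rV[R]_n -> 'rV[R]_n).
Hypothesis lc : levi_civita g nabla.
Let cn : is_connection nabla. Proof. by case: lc. Qed.
Let mn : metric_connection g nabla. Proof. by case: lc. Qed.
Let tn : torsion_free nabla. Proof. by case: lc. Qed.

Variable p : M.
Let D := chart_dom (chart_at p).
Let oD : open D. Proof. exact: chart_dom_open. Qed.
Let Dp : D p. Proof. exact: chart_at_dom. Qed.
Local Notation X_ u := (coord_field p u).
Let sX u : smooth_field D (X_ u). Proof. exact: coord_field_smooth. Qed.

Lemma nabla_coord_sym q u v : D q -> nabla (X_ v) q (X_ u q) = nabla (X_ u) q (X_ v q).
Proof.
move=> Dq; apply/eqP; rewrite -subr_eq0.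
by rewrite (tn oD (sX u) (sX v) Dq) lie_bracket_coord.
Qed.

Let nabla0 U Y : open U -> smooth_field U Y -> U p -> nabla Y p 0 = 0.
Proof.
move=> oU sY Up; have := nabla_linear cn oU sY Up 1 0 0.
rewrite !scale1r addr0 => /(congr1 (fun x => x - nabla Y p 0)).
by rewrite addrK subrr.
Qed.

Lemma curvature_coord U u v Y : open U -> U p -> smooth_field U Y ->
  curvature nabla (X_ u) (X_ v) Y p =
  nabla (fun q => nabla Y q (X_ v q)) p u - nabla (fun q => nabla Y q (X_ u q)) p v.
Proof.
move=> oU Up sY.
by rewrite /curvature lie_bracket_coord // (nabla0 oU sY Up) subr0 !coord_field_center.
Qed.

Lemma nabla_coord_smooth U u Y : open U -> smooth_field U Y ->
  smooth_field (U `&` D) (fun q => nabla Y q (X_ u q)).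
Proof.
move=> oU sY; apply: (nabla_smooth cn (openI oU oD)).
  exact: smooth_field_sub (@subIsetr _ U D) (sX u).
exact: smooth_field_sub (@subIsetl _ U D) sY.
Qed.

(** Second derivatives of the function dot Y Z along commuting coordinate
    fields commute; expanding both by the metric property leaves only the
    curvature terms. *)
Lemma curvature_skew U u v Y Z : open U -> U p -> smooth_field U Y ->
  smooth_field U Z ->
  dot g p (curvature nabla (X_ u) (X_ v) Y p) (Z p) =
  - dot g p (Y p) (curvature nabla (X_ u) (X_ v) Z p).
Proof.
move=> oU Up sY sZ; rewrite !(curvature_coord _ _ oU) //.
have oUD := openI oU oD; have UDp : (U `&` D) p by [].
have sh := smooth_dot g oU sY sZ.
have sY' := smooth_field_sub (@subIsetl _ U D) sY.
have sZ' := smooth_field_sub (@subIsetl _ U D) sZ.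
have E w z : tdiff (fun q => tdiff (fun q => dot g q (Y q) (Z q)) q (X_ z q)) p (X_ w
  p) =
    dot g p (nabla (fun q => nabla Y q (X_ z q)) p w) (Z p)
    + dot g p (nabla Y p z) (nabla Z p w)
    + (dot g p (nabla Y p w) (nabla Z p z)
    + dot g p (Y p) (nabla (fun q => nabla Z q (X_ z q)) p w)).
  have sYz := nabla_coord_smooth z oU sY; have sZz := nabla_coord_smooth z oU sZ.
  rewrite (tdiff_eq (f := fun q => dot g q (nabla Y q (X_ z q)) (Z q) +
     dot g q (Y q) (nabla Z q (X_ z q))) _ oUD UDp).
  - rewrite (@tdiffD _ _ _ _ (U `&` D) (fun q => dot g q (nabla Y q (X_ z q)) (Z q))
      (fun q => dot g q (Y q) (nabla Z q (X_ z q))));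
      [|exact: UDp|exact: (smooth_dot g oUD sYz sZ')|exact: (smooth_dot g oUD sY' sZz)].
    rewrite (mn oUD sYz sZ' _ UDp) (mn oUD sY' sZz _ UDp) !coord_field_center.
    by [].
  - by apply: smooth_mapD => //; apply: smooth_dot.
  - by move=> q [Uq Dq]; rewrite (mn oU sY sZ _ Uq).
have := E v u; rewrite -(tdiff_commute u v oU Up sh Dp) E => H.
by rewrite dotBl dotBr; lra.
Qed.

(** For commuting fields, torsion-freeness makes nabla_v X_w symmetric in v
    and w, and the six second derivatives cancel in pairs. *)
Lemma bianchi u v w :
  curvature_at nabla p u v w + curvature_at nabla p v w u
    + curvature_at nabla p w u v = 0.
Proof.
rewrite /curvature_at !(curvature_coord _ _ oD Dp) //.
have sw a b z : nabla (fun q => nabla (X_ b) q (X_ a q)) p z = nabla (fun q => nabla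
  (X_ a) q (X_ b q)) p z.
  apply: (nabla_local cn _ oD) => //; try exact: nabla_smooth.
  by move=> q Dq; exact: nabla_coord_sym.
by rewrite (sw v w u) (sw u w v) (sw v u w) !subrKA subrr.
Qed.

Lemma curvature_antisym u v w : curvature_at nabla p v u w = - curvature_at nabla p u
  v w.
Proof. by rewrite /curvature_at !(curvature_coord _ _ oD Dp) // opprB. Qed.

Lemma curvature_at_linear1 v w : linear (fun u => curvature_at nabla p u v w).
Proof.
move=> a u u'; rewrite /curvature_at !(curvature_coord _ _ oD Dp) //.
rewrite (nabla_linear cn oD (nabla_smooth cn oD (sX v) (sX w)) Dp).
have -> : nabla (fun q => nabla (X_ w) q (X_ (a *: u + u') q)) p v =
   nabla (fun q => a *: nabla (X_ w) q (X_ u q) + nabla (X_ w) q (X_ u' q)) p v.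
  apply: (nabla_local cn _ oD) => //.
  - exact: nabla_smooth.
  - apply: smooth_fieldD => //; last exact: nabla_smooth.
    exact/smooth_fieldZ/nabla_smooth.
  - by move=> q Dq; rewrite coord_fieldP (nabla_linear cn oD (sX w) Dq).
rewrite (nablaD cn _ oD); [|exact/smooth_fieldZ/nabla_smooth|exact: nabla_smooth|by []].
rewrite (nablaZ cn _ _ oD) //; last exact: nabla_smooth.
by rewrite scalerBr opprD addrACA.
Qed.

Lemma curvature_at_linear2 u w : linear (fun v => curvature_at nabla p u v w).
Proof.
move=> a v v'; rewrite !(curvature_antisym _ u) (curvature_at_linear1 u w a v v').
by rewrite opprD scalerN.
Qed.

(** The first Bianchi identity moves the last slot to the first two. *)
Lemma curvature_at_linear3 u v : linear (fun w => curvature_at nabla p u v w).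
Proof.
move=> a w w'.
(* Both terms on the right are linear in x, by the first slot. *)
have B x : curvature_at nabla p u v x =
    curvature_at nabla p x v u - curvature_at nabla p x u v.
  have := bianchi u v x; rewrite -addrA => /eqP; rewrite addr_eq0 => /eqP ->.
  by rewrite (curvature_antisym x v) opprD opprK.
rewrite !B (curvature_at_linear1 v u) (curvature_at_linear1 u v).
rewrite opprD addrACA; congr (_ + _).
by rewrite [RHS](scalerBr a (curvature_at nabla p w v u)).
Qed.

Lemma scalar_curvature_onb (b : 'I_n -> 'rV[R]_n) : orthonormal_basis g p b ->
  scalar_curvature g nabla p =
  \sum_i \sum_j dot g p (curvature_at nabla p (b i) (b j) (b j)) (b i).
Proof.
move=> ob; rewrite exchange_big /=.
have ricE v w : ricci nabla p v w = \sum_i dot g p (curvature_at nabla p (b i) v w) (b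
  i).
  exact: (onb_trace ob (curvature_at_linear1 v w)).
have expand (L : 'rV[R]_n -> 'rV[R]_n) u : linear L ->
    L u = \sum_i u 0 i *: L (delta_mx 0 i).
  move=> linL; pose LM := GRing.isLinear.Build _ _ _ _ _ linL.
  pose L' : {linear 'rV[R]_n -> 'rV[R]_n} := HB.pack L LM.
  exact: (linear_row_sum L').
have ricB j : \sum_i dot g p (curvature_at nabla p (b i) (b j) (b j)) (b i) =
   \sum_k \sum_l b j 0 k * b j 0 l * ricci nabla p (delta_mx 0 k) (delta_mx 0 l).
  transitivity (\sum_i \sum_k \sum_l b j 0 k * b j 0 l *
     dot g p (curvature_at nabla p (b i) (delta_mx 0 k) (delta_mx 0 l)) (b i)).
    apply: eq_bigr => i _.
    rewrite (expand _ (b j) (@curvature_at_linear2 (b i) (b j))) dot_suml.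
    apply: eq_bigr => k _.
    rewrite dotZl (expand _ (b j) (@curvature_at_linear3 (b i) (delta_mx 0 k)))
      dot_suml mulr_sumr.
    by apply: eq_bigr => l _; rewrite dotZl mulrA.
  rewrite exchange_big /=; apply: eq_bigr => k _.
  rewrite exchange_big /=; apply: eq_bigr => l _.
  by rewrite ricE mulr_sumr.
under [RHS]eq_bigr do rewrite ricB.
rewrite exchange_big /= /scalar_curvature; apply: eq_bigr => k _.
rewrite exchange_big /=; apply: eq_bigr => l _.
by rewrite -(onb_gram_sum ob) mulr_suml.
Qed.

End LeviCivita.
End Connections.

(** * Curvature and divergence in an orthonormal frame *)

Lemma mxBE (R : pzRingType) m n (A B : 'M[R]_(m, n)) i j : (A - B) i j = A i j - B i j.
Proof. by rewrite !mxE. Qed.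

Section FrameGeneral.
Context {R : realType} {n : nat} {M : manifold R n}.
Variables (g : riemannian_metric M) (U : set M) (e : M -> 'I_n -> 'rV[R]_n).
Hypothesis oU : open U.
Hypothesis se : forall i, smooth_field U (e^~ i).
Hypothesis oe : forall q, U q -> orthonormal_basis g q (e q).

(** Row k, column l: the l-th component in the frame e of the derivative of
    the k-th frame field along v. *)
Definition conn_coef (N : (M -> 'rV[R]_n) -> M -> 'rV[R]_n -> 'rV[R]_n)
    q (v : 'rV[R]_n) : 'M[R]_n :=
  \matrix_(k, l) dot g q (N (e^~ k) q v) (e q l).

(** The frame is orthonormal, so the functions dot e_i e_j are constant. *)
Lemma conn_coef_skew N q v i j : metric_connection g N -> U q ->
  conn_coef N q v j i = - conn_coef N q v i j.
Proof.
move=> mN Uq; rewrite !mxE; have := mN _ _ _ oU (se i) (se j) q v Uq.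
have -> : tdiff (fun q => dot g q (e q i) (e q j)) q v = 0.
  rewrite -(tdiff_cst (M := M) ((i == j)%:R : R) q v).
  apply: (tdiff_eq _ oU Uq (smooth_map_cst U ((i == j)%:R : R))) => q' Uq'.
  by rewrite oe.
by rewrite (dotC _ _ (e q i)) => /eqP; rewrite eq_sym addrC addr_eq0 => /eqP.
Qed.

Variables (nabla : (M -> 'rV[R]_n) -> M -> 'rV[R]_n -> 'rV[R]_n).
Hypothesis lc : levi_civita g nabla.

Variable p : M.
Hypothesis Up : U p.
Let D := chart_dom (chart_at p).
Let oD : open D. Proof. exact: chart_dom_open. Qed.
Let Dp : D p. Proof. exact: chart_at_dom. Qed.
Local Notation X_ u := (coord_field p u).
Let cn : is_connection nabla. Proof. by case: lc. Qed.
Let mn : metric_connection g nabla. Proof. by case: lc. Qed.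

Lemma conn_coef_smooth N v k l : is_connection N ->
  smooth_map (U `&` D) (fun q => conn_coef N q (X_ v q) k l).
Proof.
move=> cN; have oUD := openI oU oD.
have sk := smooth_field_sub (@subIsetl _ U D) (se k).
have sl := smooth_field_sub (@subIsetl _ U D) (se l).
have sX := smooth_field_sub (@subIsetr _ U D) (coord_field_smooth (M := M) p v).
have := smooth_dot g oUD (nabla_smooth cN oUD sX sk) sl.
by apply: smooth_map_eq => // q _; rewrite mxE.
Qed.

(** Structure equation in a frame. The fields X_ u and X_ v commute, so
    there is no bracket term. The metric property gives the component along
    e_l without expanding the field nabla_v e_k in the frame; the sign of the
    quadratic term comes from the skew-symmetry of the connection matrices. *)
Lemma curvature_frame u v k l :
  dot g p (curvature nabla (X_ u) (X_ v) (e^~ k) p) (e p l) =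
  tdiff (fun q => conn_coef nabla q (X_ v q) k l) p u
  - tdiff (fun q => conn_coef nabla q (X_ u q) k l) p v
  - (conn_coef nabla p u *m conn_coef nabla p v
     - conn_coef nabla p v *m conn_coef nabla p u) k l.
Proof.
have oUD := openI oU oD; have UDp : (U `&` D) p by [].
have sl := smooth_field_sub (@subIsetl _ U D) (se l).
have Dk w z : tdiff (fun q => conn_coef nabla q (X_ w q) k l) p z =
    dot g p (nabla (fun q => nabla (e^~ k) q (X_ w q)) p z) (e p l)
    - (conn_coef nabla p w *m conn_coef nabla p z) k l.
  have -> : tdiff (fun q => conn_coef nabla q (X_ w q) k l) p z =
      tdiff (fun q => dot g q (nabla (e^~ k) q (X_ w q)) (e q l)) p z.
    by congr (tdiff _ p z); apply/funext => q; rewrite mxE.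
  have sk := nabla_coord_smooth lc p w oU (se k).
  rewrite (mn oUD sk sl z UDp) coord_field_center; congr (_ + _).
  rewrite (onb_parseval (oe Up)) mxE -sumrN; apply: eq_bigr => m _.
  rewrite [conn_coef nabla p z m l]conn_coef_skew // [conn_coef nabla p z l m]mxE
    mulrN opprK mxE.
  by [].
rewrite (curvature_coord lc _ _ oU Up (se k)) dotBl !Dk mxBE.
by ring.
Qed.

(** Skew-symmetry moves the curvature from e_k to e_l, where only the value
    of the first field matters; replacing that field by a coordinate field
    with the same value at p and moving back shows that the value of e_k at p
    suffices. *)
Lemma curvature_tensorial u v k l :
  dot g p (curvature nabla (X_ u) (X_ v) (e^~ k) p) (e p l) =
  dot g p (curvature_at nabla p u v (e p k)) (e p l).
Proof.
have oUD := openI oU oD; have UDp : (U `&` D) p by [].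
have sk := smooth_field_sub (@subIsetl _ U D) (se k).
have sl := smooth_field_sub (@subIsetl _ U D) (se l).
have sX := smooth_field_sub (@subIsetr _ U D) (coord_field_smooth (M := M) p (e p k)).
rewrite (curvature_skew lc _ _ oUD UDp sk sl) /curvature_at.
have := curvature_skew lc u v oUD UDp sX sl; rewrite coord_field_center => ->.
by [].
Qed.

Lemma coord_frame_diff u v y :
  tdiff (fun q => dot g q (X_ v q) (e q y)) p u =
  dot g p (nabla (X_ v) p u) (e p y) + dot g p v (nabla (e^~ y) p u).
Proof.
have oUD := openI oU oD; have UDp : (U `&` D) p by [].
have sy := smooth_field_sub (@subIsetl _ U D) (se y).
have sX := smooth_field_sub (@subIsetr _ U D) (coord_field_smooth (M := M) p v).
by rewrite (mn oUD sX sy u UDp) coord_field_center.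
Qed.

Lemma divergence_frame (W : M -> 'rV[R]_n) : smooth_field U W ->
  divergence nabla W p =
  \sum_k (tdiff (fun q => dot g q (W q) (e q k)) p (e p k)
    - \sum_m dot g p (W p) (e p m) * conn_coef nabla p (e p k) k m).
Proof.
move=> sW; rewrite /divergence (onb_trace (oe Up) (nabla_linear cn oU sW Up)).
apply: eq_bigr => k _; rewrite (mn oU sW (se k) _ Up).
have -> : dot g p (W p) (nabla (e^~ k) p (e p k)) =
    \sum_m dot g p (W p) (e p m) * conn_coef nabla p (e p k) k m.
  by rewrite (onb_parseval (oe Up)); apply: eq_bigr => m _; rewrite mxE.
by rewrite addrK.
Qed.

End FrameGeneral.

(** * Integer identities for the components of the 3-form *)

Section Sum7.

Local Notation o7 k := (Ordinal (isT : (k < 7)%N)).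

Definition sum7 (V : nmodType) (f : 'I_7 -> V) : V :=
  f (o7 0) + (f (o7 1) + (f (o7 2) + (f (o7 3) + (f (o7 4) + (f (o7 5) + f (o7 6)))))).

Lemma sum7E (V : nmodType) (f : 'I_7 -> V) : \sum_i f i = sum7 f.
Proof.
rewrite !big_ord_recl big_ord0 addr0 /sum7.
by do ![congr (_ + _)]; congr f; apply: val_inj.
Qed.

Definition all7 (P : 'I_7 -> bool) : bool :=
  [&& P (o7 0), P (o7 1), P (o7 2), P (o7 3), P (o7 4), P (o7 5) & P (o7 6)].

(** Together with sum7E, this turns an identity between sums over 'I_7 with
    integer terms into a boolean that vm_compute evaluates. *)
Lemma all7P P : all7 P -> forall i, P i.
Proof.
case/and4P => P0 P1 P2 /and4P[P3 P4 P5 P6] [[|[|[|[|[|[|[|//]]]]]]] hi].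
- by rewrite (_ : Ordinal hi = o7 0) //; apply: val_inj.
- by rewrite (_ : Ordinal hi = o7 1) //; apply: val_inj.
- by rewrite (_ : Ordinal hi = o7 2) //; apply: val_inj.
- by rewrite (_ : Ordinal hi = o7 3) //; apply: val_inj.
- by rewrite (_ : Ordinal hi = o7 4) //; apply: val_inj.
- by rewrite (_ : Ordinal hi = o7 5) //; apply: val_inj.
- by rewrite (_ : Ordinal hi = o7 6) //; apply: val_inj.
Qed.

End Sum7.

(** The components of phi in a Cayley frame: the sign is 1 on the cyclic
    rotations of the seven triples (i, i + 1, i + 3), and -1 on the transposed
    triples. The triples are listed rather than defined by arithmetic modulo 7
    so that the identities below are checked quickly. *)
Definition eps (i j k : 'I_7) : int :=
  match nat_of_ord i, nat_of_ord j, nat_of_ord k with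
  | 0, 1, 3 | 0, 2, 6 | 0, 4, 5 | 1, 2, 4 | 1, 3, 0 | 1, 5, 6 | 2, 3, 5 | 2, 4, 1
  | 2, 6, 0 | 3, 0, 1 | 3, 4, 6 | 3, 5, 2 | 4, 1, 2 | 4, 5, 0 | 4, 6, 3 | 5, 0, 4
  | 5, 2, 3 | 5, 6, 1 | 6, 0, 2 | 6, 1, 5 | 6, 3, 4 => 1
  | 0, 3, 1 | 0, 5, 4 | 0, 6, 2 | 1, 0, 3 | 1, 4, 2 | 1, 6, 5 | 2, 0, 6 | 2, 1, 4
  | 2, 5, 3 | 3, 1, 0 | 3, 2, 5 | 3, 6, 4 | 4, 0, 5 | 4, 2, 1 | 4, 3, 6 | 5, 1, 6
  | 5, 3, 2 | 5, 4, 0 | 6, 2, 0 | 6, 4, 3 | 6, 5, 1 => -1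
  | _, _, _ => 0
  end.

Definition kron (i j : 'I_7) : int := if nat_of_ord i == j then 1 else 0.

(** The components of the coassociative 4-form, the Hodge dual of phi, read
    off from the contraction of phi with itself over one index. *)
Definition psi (i j k l : 'I_7) : int :=
  sum7 (fun m => eps i j m * eps k l m) - kron i k * kron j l + kron i l * kron j k.

Lemma epsC i j k : eps j i k = - eps i j k.
Proof.
apply/eqP; move: k; apply/all7P; move: j; apply/all7P; move: i; apply/all7P.
by vm_compute.
Qed.

Lemma eps_cyc i j k : eps j k i = eps i j k.
Proof.
apply/eqP; move: k; apply/all7P; move: j; apply/all7P; move: i; apply/all7P.
by vm_compute.
Qed.

Lemma eps_contr2 m n : 
  sum7 (fun k => sum7 (fun l => eps k l m * eps k l n)) = 6 * kron m n.
Proof.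
by apply/eqP; move: n; apply/all7P; move: m; apply/all7P; vm_compute.
Qed.

Lemma eps_contr3 x y z : sum7 (fun a => sum7 (fun b => sum7 (fun c =>
  eps a x b * eps b y c * eps c z a))) = 3 * eps x y z.
Proof.
apply/eqP; move: z; apply/all7P; move: y; apply/all7P; move: x; apply/all7P.
by vm_compute.
Qed.

(** The identity behind the quadratic terms of the scalar curvature formula:
    both sides are 3 d_ab d_cd - 2 d_ac d_bd - d_ad d_bc + psi_abcd. Contracted
    with t_ab t_cd, the left side gives the two sums that occur in the
    curvature, the right side the invariants of the torsion matrix t. *)
Lemma eps_quad a b c d :
  2 * sum7 (fun j => eps a j d * eps c b j) + sum7 (fun m => eps a c m * eps m b d) =
  3 * (kron a b * kron c d) - 3 * (kron a c * kron b d)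
    + sum7 (fun k => eps a b k * eps c d k).
Proof.
apply/eqP; move: d; apply/all7P; move: c; apply/all7P; move: b; apply/all7P; move: a;
  apply/all7P.
by vm_compute.
Qed.

Lemma psi_cyc i j k l : psi j k i l = psi i j k l.
Proof.
apply/eqP; move: l; apply/all7P; move: k; apply/all7P; move: j; apply/all7P; move: i;
  apply/all7P.
by vm_compute.
Qed.

(** The coefficient of B_ab in the (i, j, k) component of the action of a
    matrix B on phi. *)
Definition derphi_coef (i j k a b : 'I_7) : int :=
  kron i a * eps b j k + kron j a * eps i b k + kron k a * eps i j b.

(** A skew matrix acts on phi through its contraction with phi only: this is
    the decomposition of so(7) into g_2 and its complement, with the vector
    representation embedded in the 3-forms by psi. *)
Lemma derphi_coef_psi i j k a b :
  derphi_coef i j k a b - derphi_coef i j k b a =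
  - sum7 (fun m => psi i j k m * eps a b m).
Proof.
apply/eqP; move: b; apply/all7P; move: a; apply/all7P; move: k; apply/all7P.
move: j; apply/all7P; move: i; apply/all7P.
by vm_compute.
Qed.


(** For every n, one explicit component of psi recovers the n-th coordinate of
    a vector v from the 3-form psi_ijkm v_m. *)
Lemma psi_kron n m : psi (n + 1) (n + 2) (n + 5) m = kron m n.
Proof. by apply/eqP; move: m; apply/all7P; move: n; apply/all7P; vm_compute. Qed.

(** The expansion of the seven determinants wedge3 on frame vectors. *)
Lemma eps_det i j k :
  sum7 (fun l =>
    kron l i *
      (kron (l + 1) j * kron (l + 3) k - kron (l + 1) k * kron (l + 3) j)
    - kron l j *
      (kron (l + 1) i * kron (l + 3) k - kron (l + 1) k * kron (l + 3) i)
    + kron l k *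
      (kron (l + 1) i * kron (l + 3) j - kron (l + 1) j * kron (l + 3) i)) =
  eps i j k.
Proof.
apply/eqP; move: k; apply/all7P; move: j; apply/all7P; move: i; apply/all7P.
by vm_compute.
Qed.

(** * The action of so(7) on the 3-form *)

Section Algebra.
Variable R : realFieldType.
Local Notation E i j k := ((eps i j k)%:~R : R).

Lemma sum7_fun (V : nmodType) : (fun f : 'I_7 -> V => \sum_i f i) = @sum7 V.
Proof. by apply/funext => f; exact: sum7E. Qed.

Lemma epsR_swap12 i j k : E j i k = - E i j k.
Proof. by rewrite epsC rmorphN. Qed.

Lemma epsR_cyc i j k : E j k i = E i j k.
Proof. by rewrite eps_cyc. Qed.

Lemma epsR_swap23 i j k : E i k j = - E i j k.
Proof. by rewrite -epsR_cyc epsR_swap12 epsR_cyc. Qed.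

Lemma kronE i j : (kron i j)%:~R = (i == j)%:R :> R.
Proof. by rewrite /kron -val_eqE /=; case: eqP. Qed.

Lemma epsR_contr2 m n : \sum_k \sum_l E k l m * E k l n = 6%:R * (m == n)%:R.
Proof.
rewrite -kronE -(intrM R 6) -eps_contr2 -sum7_fun rmorph_sum; apply: eq_bigr => k _.
by rewrite rmorph_sum; apply: eq_bigr => l _; rewrite rmorphM.
Qed.

Lemma epsR_contr3 x y z : \sum_a \sum_b \sum_c E a x b * E b y c * E c z a = 3%:R * E
  x y z.
Proof.
rewrite -(intrM R 3) -eps_contr3 -sum7_fun rmorph_sum; apply: eq_bigr => a _.
rewrite rmorph_sum; apply: eq_bigr => b _.
by rewrite rmorph_sum; apply: eq_bigr => c _; rewrite !rmorphM.
Qed.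

Lemma epsR_quad a b c d :
  2%:R * (\sum_j E a j d * E c b j) + \sum_m E a c m * E m b d =
  3%:R * ((a == b)%:R * (c == d)%:R) - 3%:R * ((a == c)%:R * (b == d)%:R)
   + \sum_k E a b k * E c d k.
Proof.
have F (f h : 'I_7 -> int) :
    \sum_j (f j)%:~R * (h j)%:~R = (\sum_j f j * h j)%:~R :> R.
  by rewrite rmorph_sum; apply: eq_bigr => j _; rewrite rmorphM.
rewrite !F -!kronE -[2%:R]/((2 : int)%:~R) -[3%:R]/((3 : int)%:~R).
rewrite -!rmorphM -rmorphB -!rmorphD; congr intr.
by have := eps_quad a b c d; rewrite -sum7_fun.
Qed.

(** The matrix of u |-> u x e_x, acting on row vectors. These matrices span
    the complement of g_2 in so(7). *)
Definition crossmx (x : 'I_7) : 'M[R]_7 := \matrix_(k, l) E k x l.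
Local Notation Phi := crossmx.

Lemma tr_crossmx m (C : 'M[R]_7) : \tr (Phi m *m C) = \sum_k \sum_l E k l m * C k l.
Proof.
rewrite exchange_big /=; apply: eq_bigr => l _; rewrite mxE; apply: eq_bigr => k _.
by rewrite mxE epsR_cyc.
Qed.

Lemma tr_crossmx2 m n : \tr (Phi m *m Phi n) = - 6%:R * (m == n)%:R.
Proof.
rewrite tr_crossmx mulNr -epsR_contr2 -sumrN; apply: eq_bigr => k _.
by rewrite -sumrN; apply: eq_bigr => l _; rewrite mxE [E k n l]epsR_swap23 mulrN.
Qed.

Lemma tr_crossmx3 x y z : \tr (Phi x *m Phi y *m Phi z) = 3%:R * E x y z.
Proof.
rewrite -epsR_contr3; apply: eq_bigr => a _; rewrite mxE exchange_big /=.
apply: eq_bigr => c _; rewrite mxE mulr_suml; apply: eq_bigr => b _.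
by rewrite !mxE.
Qed.

Definition skew_mx (B : 'M[R]_7) := forall i j, B j i = - B i j.

(** The components of the infinitesimal action of B on phi. *)
Definition derphi (B : 'M[R]_7) i j k : R :=
  \sum_x (B i x * E x j k + B j x * E i x k + B k x * E i j x).

Lemma sum_delta_l (F : 'I_7 -> R) i : \sum_a (i == a)%:R * F a = F i.
Proof.
rewrite (bigD1 i) //= eqxx mul1r big1 ?addr0 // => a ai.
by rewrite eq_sym (negbTE ai) mul0r.
Qed.

Lemma derphiE B i j k : derphi B i j k = \sum_a \sum_b B a b * (derphi_coef i j k a
  b)%:~R.
Proof.
rewrite exchange_big; apply: eq_bigr => x _.
transitivity (\sum_a ((i == a)%:R * (B a x * E x j k) + (j == a)%:R * (B a x * E i x k)
   + (k == a)%:R * (B a x * E i j x))).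
  by rewrite !big_split /= !sum_delta_l.
by apply: eq_bigr => a _; rewrite /derphi_coef !(rmorphD, rmorphM) /= !kronE; ring.
Qed.

Lemma derphi_skew B i j k : skew_mx B ->
  2%:R * derphi B i j k = - \sum_m (psi i j k m)%:~R * \tr (Phi m *m B).
Proof.
move=> sB.
have -> : 2%:R * derphi B i j k =
    \sum_a \sum_b B a b * ((derphi_coef i j k a b)%:~R - (derphi_coef i j k b a)%:~R).
  rewrite mulr_natl mulr2n {1}derphiE derphiE [X in _ + X]exchange_big -big_split /=.
  apply: eq_bigr => a _; rewrite -big_split /=; apply: eq_bigr => b _.
  by rewrite [B b a]sB mulrBr mulNr.
have -> : \sum_m (psi i j k m)%:~R * \tr (Phi m *m B) =
    \sum_a \sum_b B a b * \sum_m (psi i j k m)%:~R * E a b m.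
  transitivity (\sum_m \sum_a \sum_b B a b * ((psi i j k m)%:~R * E a b m)).
    apply: eq_bigr => m _; rewrite tr_crossmx mulr_sumr; apply: eq_bigr => a _.
    by rewrite mulr_sumr; apply: eq_bigr => b _; rewrite mulrA mulrC.
  rewrite exchange_big; apply: eq_bigr => a _; rewrite exchange_big.
  by apply: eq_bigr => b _; rewrite mulr_sumr.
rewrite -sumrN; apply: eq_bigr => a _; rewrite -sumrN; apply: eq_bigr => b _.
rewrite -mulrN -rmorphB derphi_coef_psi -sum7_fun rmorphN rmorph_sum; congr (_ * - _).
by apply: eq_bigr => m _; rewrite rmorphM.
Qed.

(** The two descriptions of g_2 in so(7): the stabilizer of phi, and the
    orthogonal complement of the matrices crossmx m. *)
Lemma derphi0P B : skew_mx B ->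
  (forall i j k, derphi B i j k = 0) <-> (forall m, \tr (Phi m *m B) = 0).
Proof.
move=> sB; split=> [H n|H i j k].
  have := derphi_skew (n + 1) (n + 2) (n + 5) sB; rewrite H mulr0.
  under eq_bigr => m _ do rewrite psi_kron kronE eq_sym.
  by rewrite sum_delta_l => /eqP; rewrite eq_sym oppr_eq0 => /eqP.
apply/eqP; rewrite -(mulrI_eq0 _ (@mulfI _ 2%:R _)) ?pnatr_eq0 //.
by rewrite derphi_skew // big1 ?oppr0 // => m _; rewrite H mulr0.
Qed.

Definition g2mx B := skew_mx B /\ forall i j k, derphi B i j k = 0.

Lemma g2mx_tr B m : g2mx B -> \tr (Phi m *m B) = 0.
Proof. by case=> sB /(derphi0P sB). Qed.

(** Equivariance of the cross product under g_2. *)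
Lemma g2mx_comm B x : g2mx B -> Phi x *m B - B *m Phi x = \sum_y B x y *: Phi y.
Proof.
case=> sB dB; apply/matrixP => k l; rewrite !mxE summxE.
transitivity (\sum_y (B x y *: Phi y) k l - derphi B k x l); last by rewrite dB subr0.
rewrite /derphi -!sumrB; apply: eq_bigr => y _.
by rewrite !mxE [B y l]sB; ring.
Qed.

Lemma g2mx_comm_tr B C m : g2mx B ->
  \tr (Phi m *m (B *m C - C *m B)) = \sum_y B m y * \tr (Phi y *m C).
Proof.
move=> gB; rewrite mulmxBr raddfB /= !mulmxA [X in _ - X]mxtrace_mulC mulmxA.
rewrite -raddfB -mulmxBl g2mx_comm // mulmx_suml raddf_sum; apply: eq_bigr => y _.
by rewrite -scalemxAl /= mxtraceZ.
Qed.

(** Here t is the torsion matrix in a Cayley frame; A i, B i and Xi i stand for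
    the matrices of nabla, of the minimal connection and of xi along the i-th
    frame vector. The B i are arbitrary matrices in g_2, so all their terms
    must cancel against those in the covariant divergence of the vector w. *)
Section Quadratic.
Variables (t : 'M[R]_7) (A B Xi : 'I_7 -> 'M[R]_7).
Hypothesis XiE : forall i, Xi i = \sum_x t i x *: Phi x.
Hypothesis AE : forall i, A i = B i - Xi i.
Hypothesis gB : forall i, g2mx (B i).

(** The components of the vector \sum_i xi_{e_i} e_i when t is the torsion
    matrix in the frame. *)
Definition phi_contr (t : 'M[R]_7) n : R := \sum_a \sum_b E a b n * t a b.
Local Notation w := (phi_contr t).

Lemma tr_Xi i m : \tr (Phi m *m Xi i) = - 6%:R * t i m.
Proof.
rewrite XiE mulmx_sumr raddf_sum /=.
transitivity (\sum_x (m == x)%:R * (- 6%:R * t i x)); last by rewrite sum_delta_l.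
by apply: eq_bigr => x _; rewrite -scalemxAr mxtraceZ tr_crossmx2; ring.
Qed.

Lemma tr_comm_Xi i j m : \tr (Phi m *m (Xi i *m Xi j - Xi j *m Xi i)) =
  6%:R * \sum_x \sum_y t i x * t j y * E m x y.
Proof.
have F i' j' : \tr (Phi m *m (Xi i' *m Xi j')) =
    \sum_x \sum_y t i' x * t j' y * (3%:R * E m x y).
  rewrite !XiE mulmx_suml mulmx_sumr raddf_sum; apply: eq_bigr => x _.
  rewrite mulmx_sumr mulmx_sumr raddf_sum; apply: eq_bigr => y _.
  by rewrite -!scalemxAl -!scalemxAr /= !mxtraceZ mulmxA tr_crossmx3 mulrA.
rewrite mulmxBr raddfB /= !F [X in _ - X]exchange_big -sumrB mulr_sumr.
apply: eq_bigr => x _; rewrite -sumrB mulr_sumr; apply: eq_bigr => y _.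
by rewrite [E m y x]epsR_swap23; ring.
Qed.

(** The commutators of the B i lie in g_2 and are killed by the contraction
    with phi; a mixed commutator is given by the equivariance of the cross
    product. *)
Lemma tr_comm_A i j m : \tr (Phi m *m (A i *m A j - A j *m A i)) =
  6%:R * (B i *m t^T) m j - 6%:R * (B j *m t^T) m i
   + 6%:R * \sum_x \sum_y t i x * t j y * E m x y.
Proof.
have -> : A i *m A j - A j *m A i = (B i *m B j - B j *m B i)
   - (B i *m Xi j - Xi j *m B i) + (B j *m Xi i - Xi i *m B j)
   + (Xi i *m Xi j - Xi j *m Xi i).
  rewrite !AE !mulmxBl !mulmxBr.
  move: (B i *m B j) (B j *m B i) (B i *m Xi j) (Xi j *m B i) (B j *m Xi i) (Xi i *m B
    j)
    (Xi i *m Xi j) (Xi j *m Xi i) => a b c d e f k l.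
  by apply/matrixP => i' j'; rewrite !mxE; ring.
have G i' j' : \tr (Phi m *m (B i' *m Xi j' - Xi j' *m B i')) = - 6%:R * (B i' *m t^T)
  m j'.
  rewrite g2mx_comm_tr // mxE mulr_sumr; apply: eq_bigr => y _.
  by rewrite tr_Xi !mxE; ring.
have hD C D : \tr (Phi m *m (C + D)) = \tr (Phi m *m C) + \tr (Phi m *m D).
  by rewrite mulmxDr mxtraceD.
have hB C D : \tr (Phi m *m (C - D)) = \tr (Phi m *m C) - \tr (Phi m *m D).
  by rewrite mulmxBr raddfB.
rewrite hD (hD (_ - _)) (hB (_ - _) (_ - _)) !G tr_comm_Xi g2mx_comm_tr //.
rewrite big1 ?sub0r; last by move=> y _; rewrite g2mx_tr // mulr0.
by ring.
Qed.

Lemma mxtrace_mul_tr (C : 'M[R]_7) : \tr (C *m t^T) = \sum_k \sum_l C k l * t k l.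
Proof. by apply: eq_bigr => k _; rewrite mxE; apply: eq_bigr => l _; rewrite !mxE. Qed.

(** By equivariance of the cross product, the terms with B add up to the
    part of the covariant divergence of the vector phi_contr t that involves
    the connection matrices B. *)
Lemma quadB :
  \sum_i \tr (Phi i *m B i *m t^T) - \sum_i \tr (B i *m Phi i *m t^T) =
  - \sum_i \sum_n w n * B i i n.
Proof.
rewrite -sumrB -sumrN; apply: eq_bigr => i _.
rewrite -raddfB -mulmxBl g2mx_comm // mulmx_suml raddf_sum -sumrN.
apply: eq_bigr => n _; rewrite -scalemxAl /= mxtraceZ mulrC -mulNr; congr (_ * _).
rewrite mxtrace_mul_tr /phi_contr -sumrN; apply: eq_bigr => k _; rewrite -sumrN;
  apply: eq_bigr => l _.
by rewrite mxE epsR_swap23 mulNr.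
Qed.

Lemma sum_eps_mul i (C : 'M[R]_7) :
  \sum_j \sum_m E i j m * (C *m t^T) m j = - \tr (Phi i *m C *m t^T).
Proof.
rewrite -mulmxA -sumrN; apply: eq_bigr => j _; rewrite mxE -sumrN;
  apply: eq_bigr => m _.
by rewrite [Phi i j m]mxE [E j i m]epsR_swap12 mulNr opprK.
Qed.

Let T1 := \sum_a \sum_b \sum_c \sum_d t a b * t c d * \sum_j E a j d * E c b j.
Let T2 := \sum_a \sum_b \sum_c \sum_d t a b * t c d * \sum_m E a c m * E m b d.

Lemma quadXi1 : \sum_i \tr (Xi i *m Phi i *m t^T) = - T1.
Proof.
rewrite -sumrN; apply: eq_bigr => i _.
rewrite XiE !mulmx_suml raddf_sum -sumrN; apply: eq_bigr => x _.
rewrite -!scalemxAl /= mxtraceZ mxtrace_mul_tr mulr_sumr -sumrN; apply: eq_bigr => k _.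
rewrite mulr_sumr -sumrN; apply: eq_bigr => l _.
rewrite mxE -mulrA -mulrN; congr (_ * _); rewrite mulrC -mulrN -sumrN; congr (_ * _).
by apply: eq_bigr => j _; rewrite !mxE [E j i l]epsR_swap12; ring.
Qed.

Lemma quadXi2 :
  \sum_i \sum_j \sum_m E i j m * \sum_x \sum_y t i x * t j y * E m x y = T2.
Proof.
apply: eq_bigr => a _; rewrite [RHS]exchange_big /=; apply: eq_bigr => c _.
transitivity (\sum_m \sum_x \sum_y t a x * t c y * (E a c m * E m x y)).
  apply: eq_bigr => m _; rewrite mulr_sumr; apply: eq_bigr => x _.
  by rewrite mulr_sumr; apply: eq_bigr => y _; ring.
rewrite exchange_big; apply: eq_bigr => x _; rewrite exchange_big;
  apply: eq_bigr => y _.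
by rewrite mulr_sumr.
Qed.

Lemma quadT : 2%:R * T1 + T2 = 3%:R * (\tr t) ^+ 2 - 3%:R * (\sum_a \sum_b t a b ^+ 2)
  + \sum_n w n ^+ 2.
Proof.
have -> : (\tr t) ^+ 2 = \sum_a \sum_b \sum_c \sum_d t a b * t c d * ((a == b)%:R * (c
  == d)%:R).
  rewrite expr2 {1}/mxtrace mulr_suml; apply: eq_bigr => a _.
  rewrite -(sum_delta_l (fun b => t a b * \tr t)); apply: eq_bigr => b _.
  rewrite /mxtrace mulrA mulr_sumr; apply: eq_bigr => c _.
  rewrite -(sum_delta_l (fun d => _ * t c d)); apply: eq_bigr => d _.
  by ring.
have -> : \sum_a \sum_b t a b ^+ 2 =
    \sum_a \sum_b \sum_c \sum_d t a b * t c d * ((a == c)%:R * (b == d)%:R).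
  apply: eq_bigr => a _; apply: eq_bigr => b _; rewrite expr2.
  rewrite -(sum_delta_l (fun c => t a b * t c b)); apply: eq_bigr => c _.
  rewrite mulrA -(sum_delta_l (fun d => _ * t a b * t c d)); apply: eq_bigr => d _.
  by ring.
have -> : \sum_n w n ^+ 2 = \sum_a \sum_b \sum_c \sum_d t a b * t c d * (\sum_k E a b
  k * E c d k).
  transitivity (\sum_n \sum_a \sum_b \sum_c \sum_d t a b * t c d * (E a b n * E c d n)).
    apply: eq_bigr => n _; rewrite expr2 {1}/phi_contr mulr_suml; apply: eq_bigr => a _.
    rewrite mulr_suml; apply: eq_bigr => b _; rewrite /phi_contr mulr_sumr;
      apply: eq_bigr => c _.
    by rewrite mulr_sumr; apply: eq_bigr => d _; ring.
  rewrite exchange_big; apply: eq_bigr => a _; rewrite exchange_big;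
    apply: eq_bigr => b _.
  rewrite exchange_big; apply: eq_bigr => c _; rewrite exchange_big;
    apply: eq_bigr => d _.
  by rewrite mulr_sumr.
pose Q F := \sum_a \sum_b \sum_c \sum_d t a b * t c d * F a b c d.
have QD F G : Q (fun a b c d => F a b c d + G a b c d) = Q F + Q G.
  rewrite /Q; do 4![rewrite -big_split /=; apply: eq_bigr => ? _].
  by rewrite mulrDr.
have QZ k F : Q (fun a b c d => k * F a b c d) = k * Q F.
  rewrite /Q; do 4![rewrite mulr_sumr; apply: eq_bigr => ? _].
  by rewrite mulrCA.
rewrite -mulNr -!QZ -!QD.
do 4![apply: eq_bigr => ? _]; congr (_ * _).
by rewrite epsR_quad mulNr.
Qed.

Lemma quadratic_identity :
  - 12%:R * (\sum_i \tr (A i *m Phi i *m t^T))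
  - \sum_i \sum_j \sum_m E i j m * \tr (Phi m *m (A i *m A j - A j *m A i)) =
  - 12%:R * (\sum_k \sum_n w n * A k k n)
  - 18%:R * ((\tr t) ^+ 2 - (\sum_a \sum_b t a b ^+ 2) + \sum_n w n ^+ 2).
Proof.
have -> : \sum_i \tr (A i *m Phi i *m t^T) = \sum_i \tr (B i *m Phi i *m t^T) + T1.
  rewrite -[T1]opprK -quadXi1 -sumrB; apply: eq_bigr => i _.
  by rewrite AE !mulmxBl raddfB.
have -> : \sum_i \sum_j \sum_m E i j m * \tr (Phi m *m (A i *m A j - A j *m A i)) =
    - 12%:R * (\sum_i \tr (Phi i *m B i *m t^T)) + 6%:R * T2.
  pose S1 := \sum_i \sum_j \sum_m E i j m * (B i *m t^T) m j.
  have S1E : S1 = - \sum_i \tr (Phi i *m B i *m t^T).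
    by rewrite -sumrN; apply: eq_bigr => i _; rewrite sum_eps_mul.
  pose S2 := \sum_i \sum_j \sum_m E i j m * (B j *m t^T) m i.
  have S2E : S2 = - S1.
    rewrite /S2 exchange_big -sumrN; apply: eq_bigr => i _.
    rewrite -sumrN; apply: eq_bigr => j _; rewrite -sumrN; apply: eq_bigr => m _.
    by rewrite epsR_swap12 mulNr.
  transitivity (6%:R * S1 - 6%:R * S2 + 6%:R * T2); last by rewrite S2E S1E; ring.
  rewrite -quadXi2 /S1 /S2.
  do 3![rewrite !mulr_sumr -?sumrB -?big_split /=; apply: eq_bigr => ? _].
  by rewrite tr_comm_A; ring.
have -> : \sum_k \sum_n w n * A k k n = \sum_k \sum_n w n * B k k n - \sum_n w n ^+ 2.
  have -> : \sum_n w n ^+ 2 = \sum_k \sum_n w n * Xi k k n.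
    rewrite exchange_big; apply: eq_bigr => n _; rewrite expr2 -mulr_sumr;
      congr (_ * _).
    rewrite {1}/phi_contr; apply: eq_bigr => k _; rewrite XiE summxE;
      apply: eq_bigr => x _.
    by rewrite !mxE mulrC.
  rewrite -sumrB; apply: eq_bigr => k _; rewrite -sumrB; apply: eq_bigr => n _.
  by rewrite AE mxE [(- Xi k) k n]mxE mulrBr.
have := quadB; have := quadT.
by lra.
Qed.

End Quadratic.

End Algebra.

(** * Components of the torsion and the pointwise scalar curvature formula *)

Section Algebra2.
Variable R : realFieldType.
Local Notation E i j k := ((eps i j k)%:~R : R).
Local Notation Phi := (crossmx R).
Local Notation w := phi_contr.

Definition sqnorm_mx (a : 'M[R]_7) : R := \sum_i \sum_j a i j ^+ 2.

Lemma phi_contrE (t : 'M[R]_7) n : phi_contr t n = \tr (Phi n *m t).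
Proof. by rewrite tr_crossmx. Qed.

Lemma phi_contrD (a b : 'M[R]_7) n : phi_contr (a + b) n = phi_contr a n
  + phi_contr b n.
Proof. by rewrite !phi_contrE mulmxDr mxtraceD. Qed.

(** In dimension 7, \sum_j |e_j x u|^2 = 6 |u|^2. *)
Lemma sum_cross_sq (a : 'M[R]_7) :
  \sum_i \sum_j \sum_n (\sum_x a i x * E j x n) ^+ 2 = 6%:R * sqnorm_mx a.
Proof.
rewrite /sqnorm_mx mulr_sumr; apply: eq_bigr => i _.
transitivity (\sum_x \sum_y a i x * a i y * (\sum_j \sum_n E j x n * E j y n)).
  transitivity (\sum_j \sum_n \sum_x \sum_y a i x * a i y * (E j x n * E j y n)).
    apply: eq_bigr => j _; apply: eq_bigr => n _; rewrite expr2 mulr_suml.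
    by apply: eq_bigr => x _; rewrite mulr_sumr; apply: eq_bigr => y _; ring.
  under eq_bigr => j _ do rewrite exchange_big /=.
  rewrite exchange_big; apply: eq_bigr => x _.
  under eq_bigr => j _ do rewrite exchange_big /=.
  rewrite exchange_big; apply: eq_bigr => y _.
  by rewrite mulr_sumr; apply: eq_bigr => j _; rewrite mulr_sumr.
rewrite mulr_sumr; apply: eq_bigr => x _.
rewrite -(sum_delta_l (fun y => 6%:R * (a i x * a i y))); apply: eq_bigr => y _.
have -> : \sum_j \sum_n E j x n * E j y n = 6%:R * (x == y)%:R.
  rewrite -epsR_contr2 exchange_big; apply: eq_bigr => n _; apply: eq_bigr => j _.
  by rewrite -(epsR_cyc _ n j x) -(epsR_cyc _ n j y).
by ring.
Qed.

Definition mx_dot (a b : 'M[R]_7) : R := \sum_i \sum_j a i j * b i j.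

Lemma mx_dotC a b : mx_dot a b = mx_dot b a.
Proof. by apply: eq_bigr => i _; apply: eq_bigr => j _; rewrite mulrC. Qed.

Lemma mx_dotDl a b c : mx_dot (a + b) c = mx_dot a c + mx_dot b c.
Proof.
rewrite /mx_dot -big_split; apply: eq_bigr => i _; rewrite -big_split.
by apply: eq_bigr => j _; rewrite mxE mulrDl.
Qed.

Lemma mx_dotDr a b c : mx_dot c (a + b) = mx_dot c a + mx_dot c b.
Proof. by rewrite mx_dotC mx_dotDl !(mx_dotC _ c). Qed.

Lemma mx_dotZr k a b : mx_dot a (k *: b) = k * mx_dot a b.
Proof.
rewrite /mx_dot mulr_sumr; apply: eq_bigr => i _; rewrite mulr_sumr.
by apply: eq_bigr => j _; rewrite mxE mulrCA.
Qed.

Lemma sqnorm_mxE a : sqnorm_mx a = mx_dot a a.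
Proof. by apply: eq_bigr => i _; apply: eq_bigr => j _. Qed.

Lemma mx_dot_sym_skew (a b : 'M[R]_7) : (forall i j, a j i = a i j) -> skew_mx b ->
  mx_dot a b = 0.
Proof.
move=> sa sb; suff H : mx_dot a b = - mx_dot a b by lra.
rewrite {1}/mx_dot exchange_big -sumrN; apply: eq_bigr => i _; rewrite -sumrN.
by apply: eq_bigr => j _; rewrite sa sb mulrN.
Qed.

Lemma mx_dot_crossmx a k : mx_dot a (Phi k) = - phi_contr a k.
Proof.
rewrite -sumrN; apply: eq_bigr => i _; rewrite -sumrN; apply: eq_bigr => j _.
by rewrite mxE epsR_swap23 mulrN mulrC.
Qed.

Lemma skew_crossmx k : skew_mx (Phi k).
Proof. by move=> i j; rewrite !mxE -epsR_cyc epsR_swap12 -epsR_cyc. Qed.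

(** All four squared norms are combinations of the three invariants on the
    right. The component t4 is recovered from its contraction with phi: its
    difference S with the corresponding combination of the matrices crossmx k
    lies in g_2, hence is orthogonal to t4. *)
Lemma components_norm (t t1 t2 t3 t4 : 'M[R]_7) :
  t = t1 + t2 + t3 + t4 -> t1 = (7%:R^-1 * \tr t)%:M ->
  g2mx t2 -> (forall i j, t3 j i = t3 i j) -> \tr t3 = 0 ->
  skew_mx t4 -> (forall b, g2mx b -> mx_dot t4 b = 0) ->
  54%:R * sqnorm_mx t1 - 9%:R * sqnorm_mx t2 - 9%:R * sqnorm_mx t3
    + 45%:R * sqnorm_mx t4 =
  9%:R * ((\tr t) ^+ 2 - (\sum_a \sum_b t a b ^+ 2) + \sum_n phi_contr t n ^+ 2).
Proof.
move=> tE t1E g2 s3 tr3 s4 p4.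
have s1 i j : t1 j i = t1 i j by rewrite t1E !mxE eq_sym.
have [sk2 _] := g2.
have vs (a : 'M[R]_7) n : (forall i j, a j i = a i j) -> phi_contr a n = 0.
  move=> sa; apply/eqP; rewrite -oppr_eq0 -mx_dot_crossmx mx_dot_sym_skew //.
  exact: skew_crossmx.
have -> : \sum_n phi_contr t n ^+ 2 = \sum_n phi_contr t4 n ^+ 2.
  apply: eq_bigr => n _; rewrite tE !phi_contrD (vs t1) // (vs t3) //.
  by rewrite [phi_contr t2 n]phi_contrE g2mx_tr // !add0r.
have n4 : sqnorm_mx t4 = 6%:R^-1 * \sum_n phi_contr t4 n ^+ 2.
  (* t4 minus its projection onto the span of the crossmx k: these matrices are
     orthogonal of squared norm 6, and the contraction with phi is minus the
     inner product with them *)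
  pose S := t4 + 6%:R^-1 *: \sum_k phi_contr t4 k *: Phi k.
  have gS : g2mx S.
    have sS : skew_mx S.
      move=> i j; rewrite !mxE !summxE s4 opprD -mulrN -sumrN; congr (_ + _ * _).
      by apply: eq_bigr => k _; rewrite mxE skew_crossmx mulrN [in RHS]mxE.
    split=> //; apply/(derphi0P sS) => m.
    rewrite mulmxDr mxtraceD -phi_contrE -scalemxAr mxtraceZ mulmx_sumr raddf_sum /=.
    rewrite (eq_bigr (fun k => (m == k)%:R * (- 6%:R * phi_contr t4 k))); last first.
      by move=> k _; rewrite -scalemxAr mxtraceZ tr_crossmx2; ring.
    by rewrite sum_delta_l; field.
  have := p4 S gS; rewrite mx_dotDr -sqnorm_mxE mx_dotZr => H.
  have -> : \sum_n phi_contr t4 n ^+ 2 = - mx_dot t4 (\sum_k phi_contr t4 k *: Phi k).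
    have ip_sum (I : Type) (r : seq I) (f : I -> 'M[R]_7) :
      mx_dot t4 (\sum_(k <- r) f k) = \sum_(k <- r) mx_dot t4 (f k).
      elim: r => [|k r IH]; last by rewrite !big_cons mx_dotDr IH.
      by rewrite !big_nil -(scale0r 0) mx_dotZr mul0r.
    rewrite ip_sum -sumrN; apply: eq_bigr => k _.
    by rewrite mx_dotZr mx_dot_crossmx mulrN opprK.
  by lra.
have n1 : sqnorm_mx t1 = 7%:R^-1 * (\tr t) ^+ 2.
  rewrite /sqnorm_mx t1E; transitivity (\sum_(i < 7) (7%:R^-1 * \tr t) ^+ 2).
    apply: eq_bigr => i _; rewrite -(sum_delta_l (fun=> _ ^+ 2) i).
    apply: eq_bigr => j _; rewrite !mxE.
    by case: (i == j); rewrite ?mulr1n ?mulr0n ?mul1r ?mul0r ?expr0n.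
  by rewrite sumr_const card_ord -mulr_natr; field.
have i13 : mx_dot t1 t3 = 0.
  transitivity (7%:R^-1 * \tr t * \tr t3); last by rewrite tr3 mulr0.
  rewrite [\tr t3]/mxtrace [RHS]mulr_sumr t1E; apply: eq_bigr => i _.
  rewrite -[RHS](sum_delta_l (fun j => 7%:R^-1 * \tr t * t3 i j));
    apply: eq_bigr => j _.
  by rewrite !mxE; case: (i == j); rewrite ?mulr1n ?mulr0n ?mul1r ?mul0r.
have i12 := mx_dot_sym_skew s1 sk2; have i14 := mx_dot_sym_skew s1 s4.
have i32 := mx_dot_sym_skew s3 sk2; have i34 := mx_dot_sym_skew s3 s4.
have i42 := p4 _ g2.
have -> : \sum_a \sum_b t a b ^+ 2 = sqnorm_mx t1 + sqnorm_mx t2 + sqnorm_mx t3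
  + sqnorm_mx t4.
  rewrite -[LHS]/(sqnorm_mx t) !sqnorm_mxE {}tE !mx_dotDl !mx_dotDr.
  rewrite !(mx_dotC t2 t1) !(mx_dotC t3 t1) !(mx_dotC t4 t1) (mx_dotC t2 t3) (mx_dotC
    t4 t3) (mx_dotC t2 t4).
  by rewrite i12 i13 i14 i32 i34 i42; ring.
by lra.
Qed.

Lemma epsR_contr1 i j k l : \sum_m E i j m * E k l m =
  (i == k)%:R * (j == l)%:R - (i == l)%:R * (j == k)%:R + (psi i j k l)%:~R.
Proof.
have F : \sum_m E i j m * E k l m = (\sum_m eps i j m * eps k l m)%:~R.
  by rewrite rmorph_sum; apply: eq_bigr => m _; rewrite rmorphM.
rewrite F -!kronE -!rmorphM -rmorphB -rmorphD; congr intr.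
by rewrite /psi -sum7_fun; ring.
Qed.

(** The contraction of phi with itself over m consists of Kronecker symbols,
    which produce scalar curvatures, and of psi. As psi is invariant under
    cyclic permutations of i, j, k, the Bianchi identity kills its part. *)
Lemma curvature_contraction (Rm : 'I_7 -> 'I_7 -> 'I_7 -> 'I_7 -> R) :
  (forall i j k l, Rm i j k l + Rm j k i l + Rm k i j l = 0) ->
  (forall i j k l, Rm j i k l = - Rm i j k l) ->
  \sum_i \sum_j \sum_m E i j m * (\sum_k \sum_l E k l m * Rm i j k l) =
  - 2%:R * \sum_i \sum_j Rm i j j i.
Proof.
move=> H1 H2.
transitivity (\sum_i \sum_j \sum_k \sum_l Rm i j k l * (\sum_m E i j m * E k l m)).
  apply: eq_bigr => i _; apply: eq_bigr => j _.
  transitivity (\sum_m \sum_k \sum_l Rm i j k l * (E i j m * E k l m)).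
    apply: eq_bigr => m _; rewrite mulr_sumr; apply: eq_bigr => k _.
    by rewrite mulr_sumr; apply: eq_bigr => l _; ring.
  rewrite exchange_big; apply: eq_bigr => k _; rewrite exchange_big.
  by apply: eq_bigr => l _; rewrite mulr_sumr.
pose S := \sum_i \sum_j \sum_k \sum_l Rm i j k l * (psi i j k l)%:~R.
have S0 : S = 0.
  suff : S + S + S = 0 by move=> H; lra.
  have c1 : S = \sum_i \sum_j \sum_k \sum_l Rm j k i l * (psi i j k l)%:~R.
    rewrite /S [RHS]exchange_big /=; apply: eq_bigr => i _.
    rewrite [RHS]exchange_big /=; apply: eq_bigr => j _.
    by apply: eq_bigr => k _; apply: eq_bigr => l _; rewrite -(psi_cyc k i j).
  have c2 : S = \sum_i \sum_j \sum_k \sum_l Rm k i j l * (psi i j k l)%:~R.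
    rewrite {1}c1 [RHS]exchange_big /=; apply: eq_bigr => i _.
    rewrite [RHS]exchange_big /=; apply: eq_bigr => j _.
    by apply: eq_bigr => k _; apply: eq_bigr => l _; rewrite -(psi_cyc k i j).
  rewrite {2}c1 {2}c2 /S -!big_split /=; apply: big1 => i _.
  rewrite -!big_split /=; apply: big1 => j _; rewrite -!big_split /=;
    apply: big1 => k _.
  by rewrite -!big_split /=; apply: big1 => l _; rewrite -!mulrDl H1 mul0r.
have s1 : \sum_i \sum_j \sum_k \sum_l Rm i j k l * ((i == k)%:R * (j == l)%:R) =
    \sum_i \sum_j Rm i j i j.
  apply: eq_bigr => i _; apply: eq_bigr => j _.
  rewrite -[RHS](sum_delta_l (fun k => Rm i j k j)); apply: eq_bigr => k _.
  rewrite -(sum_delta_l (fun l => _ * Rm i j k l)); apply: eq_bigr => l _.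
  by ring.
have s2 : \sum_i \sum_j \sum_k \sum_l Rm i j k l * ((i == l)%:R * (j == k)%:R) =
    \sum_i \sum_j Rm i j j i.
  apply: eq_bigr => i _; apply: eq_bigr => j _.
  rewrite -[RHS](sum_delta_l (fun k => Rm i j k i)); apply: eq_bigr => k _.
  rewrite -(sum_delta_l (fun l => _ * Rm i j k l)); apply: eq_bigr => l _.
  by ring.
have s3 : \sum_i \sum_j Rm i j i j = - \sum_i \sum_j Rm i j j i.
  rewrite exchange_big -sumrN; apply: eq_bigr => i _; rewrite -sumrN.
  by apply: eq_bigr => j _; rewrite H2.
transitivity (\sum_i \sum_j \sum_k \sum_l Rm i j k l * ((i == k)%:R * (j == l)%:R)
   - \sum_i \sum_j \sum_k \sum_l Rm i j k l * ((i == l)%:R * (j == k)%:R) + S).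
  rewrite -sumrB -big_split; apply: eq_bigr => i _; rewrite -sumrB -big_split;
    apply: eq_bigr => j _.
  rewrite -sumrB -big_split; apply: eq_bigr => k _; rewrite -sumrB -big_split;
    apply: eq_bigr => l _.
  by rewrite epsR_contr1 /=; ring.
by rewrite s1 s2 s3 S0; ring.
Qed.

(** The scalar curvature formula at a point, as an identity between the
    connection matrices A i, the curvature Rm, the torsion matrix t and the
    array Dt i of its derivatives along e_i. The last hypothesis is the
    structure equation contracted with phi. The array G holds covariant
    derivatives of coordinate fields; it is symmetric because they commute, and
    disappears when contracted with phi. *)
Lemma scalar_identity (t : 'M[R]_7) (A B Xi : 'I_7 -> 'M[R]_7)
    (Dt G : 'I_7 -> 'I_7 -> 'I_7 -> R) (Rm : 'I_7 -> 'I_7 -> 'I_7 -> 'I_7 -> R) :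
  (forall i, Xi i = \sum_x t i x *: Phi x) ->
  (forall i, A i = B i - Xi i) ->
  (forall i, g2mx (B i)) ->
  (forall i j k l, Rm i j k l + Rm j k i l + Rm k i j l = 0) ->
  (forall i j k l, Rm j i k l = - Rm i j k l) ->
  (forall i j y, G j i y = G i j y) ->
  (forall i j m, \sum_k \sum_l E k l m * Rm i j k l =
     6%:R * (Dt i j m + \sum_y (G i j y + A i y j) * t y m)
     - 6%:R * (Dt j i m + \sum_y (G j i y + A j y i) * t y m)
     - \tr (Phi m *m (A i *m A j - A j *m A i))) ->
  \sum_i \sum_j Rm i j j i =
  9%:R * ((\tr t) ^+ 2 - (\sum_a \sum_b t a b ^+ 2) + \sum_n phi_contr t n ^+ 2)
  - 6%:R * (\sum_i \sum_j \sum_m E i j m * Dt i j m - \sum_k \sum_n phi_contr t n * A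
    k k n).
Proof.
move=> XiE AE gB H1 H2 sG H.
have := curvature_contraction H1 H2.
have -> : \sum_i \sum_j \sum_m E i j m * (\sum_k \sum_l E k l m * Rm i j k l) =
    12%:R * (\sum_i \sum_j \sum_m E i j m * Dt i j m)
    - 12%:R * (\sum_i \tr (A i *m Phi i *m t^T))
    - \sum_i \sum_j \sum_m E i j m * \tr (Phi m *m (A i *m A j - A j *m A i)).
  pose X i j m := Dt i j m + \sum_y (G i j y + A i y j) * t y m.
  pose S := \sum_i \sum_j \sum_m E i j m * X i j m.
  pose S' := \sum_i \sum_j \sum_m E i j m * X j i m.
  have S'E : S' = - S.
    rewrite /S' exchange_big -sumrN; apply: eq_bigr => i _; rewrite -sumrN.
    by apply: eq_bigr => j _; rewrite -sumrN; apply: eq_bigr => m _;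
      rewrite epsR_swap12 mulNr.
  pose SG := \sum_i \sum_j \sum_m E i j m * \sum_y G i j y * t y m.
  have SG0 : SG = 0.
    suff : SG = - SG by move=> HS; lra.
    rewrite {1}/SG exchange_big -sumrN; apply: eq_bigr => i _; rewrite -sumrN.
    apply: eq_bigr => j _; rewrite -sumrN; apply: eq_bigr => m _;
      rewrite epsR_swap12 mulNr.
    by congr (- (_ * _)); apply: eq_bigr => y _; rewrite sG.
  have SE : S = \sum_i \sum_j \sum_m E i j m * Dt i j m
    + SG - \sum_i \tr (A i *m Phi i *m t^T).
    rewrite /S /SG -big_split -sumrB; apply: eq_bigr => i _ /=.
    have -> : \tr (A i *m Phi i *m t^T) = - \sum_j \sum_m E i j m * \sum_y A i y j * t
      y m.
      rewrite mxtrace_mul_tr -sumrN.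
      transitivity (\sum_k \sum_m \sum_j - (E i j m * A i k j * t k m)).
        apply: eq_bigr => k _; apply: eq_bigr => m _; rewrite mxE mulr_suml.
        by apply: eq_bigr => j _; rewrite mxE [E j i m]epsR_swap12; ring.
      transitivity (\sum_m \sum_j \sum_k - (E i j m * A i k j * t k m)).
        by rewrite exchange_big; apply: eq_bigr => m _; rewrite exchange_big.
      rewrite exchange_big; apply: eq_bigr => j _; rewrite -sumrN;
        apply: eq_bigr => m _.
      by rewrite mulr_sumr -sumrN; apply: eq_bigr => k _; ring.
    rewrite opprK -big_split -big_split; apply: eq_bigr => j _ /=.
    rewrite -big_split -big_split; apply: eq_bigr => m _ /=.
    rewrite /X -!mulrDr; congr (_ * _); rewrite -addrA -big_split /=; congr (_ + _).
    by apply: eq_bigr => y _; rewrite mulrDl.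
  transitivity (6%:R * S - 6%:R * S' - \sum_i \sum_j \sum_m E i j m * \tr (Phi m *m (A
    i *m A j - A j *m A i))).
    rewrite /S /S'; do 3![rewrite !mulr_sumr -!sumrB; apply: eq_bigr => ? _].
    by rewrite H /X; ring.
  by rewrite S'E SE SG0; ring.
have := quadratic_identity XiE AE gB; lra.
Qed.

End Algebra2.

(** * A Cayley basis of a tangent space *)

Section G2.
Context {R : realType} {M : manifold R 7}.
Variables (g : riemannian_metric M)
  (phi : M -> 'rV[R]_7 -> 'rV[R]_7 -> 'rV[R]_7 -> R)
  (cross : M -> 'rV[R]_7 -> 'rV[R]_7 -> 'rV[R]_7).
Local Notation E i j k := ((eps i j k)%:~R : R).
Local Notation Phi := (crossmx R).
Hypothesis crossP : cross_product g phi cross.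

Lemma dual_basis_onb p (b : 'I_7 -> 'rV[R]_7) i u :
  orthonormal_basis g p b -> dual_basis b i u = dot g p u (b i).
Proof.
move=> ob; rewrite /dual_basis.
have uE : u = (\row_j dot g p u (b j)) *m \matrix_j b j.
  rewrite {1}(onb_expand ob u) mulmx_sum_row; apply: eq_bigr => j _.
  by rewrite mxE rowK.
by rewrite {1}uE mulmxK ?(onb_unit ob) // mxE.
Qed.

Section Pointwise.
Variables (p : M) (b : 'I_7 -> 'rV[R]_7).
Hypothesis ob : orthonormal_basis g p b.
Hypothesis phiP : forall u v w, phi p u v w = \sum_(i : 'I_7)
  wedge3 (dual_basis b i) (dual_basis b (i + 1)) (dual_basis b (i + 3)) u v w.

Lemma wedge3E (a1 a2 a3 : 'rV[R]_7 -> R) u v w : wedge3 a1 a2 a3 u v w =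
  a1 u * (a2 v * a3 w - a2 w * a3 v) - a1 v * (a2 u * a3 w - a2 w * a3 u)
  + a1 w * (a2 u * a3 v - a2 v * a3 u).
Proof.
rewrite /wedge3 (expand_det_row _ 0) !big_ord_recl big_ord0 /cofactor.
rewrite !(expand_det_row _ 0) !big_ord_recl !big_ord0 /cofactor !det_mx11 !mxE /=.
by rewrite !exprS !expr0; ring.
Qed.

Lemma phi_frame u v w : phi p u v w =
  \sum_i \sum_j \sum_k dot g p u (b i) * dot g p v (b j) * dot g p w (b k) * E i j k.
Proof.
pose x i := dot g p u (b i); pose y i := dot g p v (b i); pose z i := dot g p w (b i).
pose T F := \sum_i \sum_j \sum_k x i * y j * z k * F i j k.
have TD F G : T (fun i j k => F i j k + G i j k) = T F + T G.
  rewrite /T; do 3![rewrite -big_split /=; apply: eq_bigr => ? _].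
  by rewrite mulrDr.
have TN F : T (fun i j k => - F i j k) = - T F.
  rewrite /T; do 3![rewrite -sumrN; apply: eq_bigr => ? _].
  by rewrite mulrN.
have TS (F : 'I_7 -> 'I_7 -> 'I_7 -> 'I_7 -> R) :
    T (fun i j k => \sum_l F l i j k) = \sum_l T (F l).
  rewrite /T [RHS]exchange_big; apply: eq_bigr => i _ /=.
  rewrite [RHS]exchange_big; apply: eq_bigr => j _ /=.
  rewrite [RHS]exchange_big; apply: eq_bigr => k _ /=.
  by rewrite mulr_sumr.
have T3 a c d : T (fun i j k => (a == i)%:R * ((c == j)%:R * (d == k)%:R)) = x a * y c
  * z d.
  rewrite -(sum_delta_l (fun i => x i * y c * z d)); apply: eq_bigr => i _.
  rewrite -(sum_delta_l (fun j => (a == i)%:R * (x i * y j * z d)));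
    apply: eq_bigr => j _.
  rewrite -(sum_delta_l (fun k => (c == j)%:R * ((a == i)%:R * (x i * y j * z k)))).
  by apply: eq_bigr => k _; ring.
transitivity (T (fun i j k => E i j k)); last by [].
transitivity (T (fun i j k => \sum_l
    ((l == i)%:R * ((l + 1 == j)%:R * (l + 3 == k)%:R)
    + - ((l == i)%:R * ((l + 3 == j)%:R * (l + 1 == k)%:R))
    + - ((l + 1 == i)%:R * ((l == j)%:R * (l + 3 == k)%:R))
    + ((l + 3 == i)%:R * ((l == j)%:R * (l + 1 == k)%:R))
    + ((l + 1 == i)%:R * ((l + 3 == j)%:R * (l == k)%:R))
    + - ((l + 3 == i)%:R * ((l + 1 == j)%:R * (l == k)%:R))))).
  rewrite TS phiP; apply: eq_bigr => l _.
  rewrite !TD !TN !T3 wedge3E !(dual_basis_onb _ _ ob) /x /y /z.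
  by ring.
rewrite /T; do 3![apply: eq_bigr => ? _]; congr (_ * _).
rewrite -eps_det -sum7_fun rmorph_sum; apply: eq_bigr => l _.
by rewrite !(rmorphD, rmorphN, rmorphM) /= !kronE; ring.
Qed.

Lemma phi_frame1 u j k : phi p u (b j) (b k) = \sum_a dot g p u (b a) * E a j k.
Proof.
rewrite phi_frame; apply: eq_bigr => a _.
rewrite -(sum_delta_l (fun j => dot g p u (b a) * E a j k)); apply: eq_bigr => j' _.
rewrite -(sum_delta_l (fun k => (j == j')%:R * (dot g p u (b a) * E a j' k))).
by apply: eq_bigr => k' _; rewrite !ob; ring.
Qed.

Lemma phi_frame2 u i k : phi p (b i) u (b k) = \sum_a dot g p u (b a) * E i a k.
Proof.
rewrite phi_frame -(sum_delta_l (fun i => \sum_a dot g p u (b a) * E i a k)).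
apply: eq_bigr => i' _; rewrite mulr_sumr; apply: eq_bigr => a _.
rewrite -(sum_delta_l (fun k => (i == i')%:R * (dot g p u (b a) * E i' a k))).
by apply: eq_bigr => k' _; rewrite !ob; ring.
Qed.

Lemma phi_frame3 u i j : phi p (b i) (b j) u = \sum_a dot g p u (b a) * E i j a.
Proof.
rewrite phi_frame -(sum_delta_l (fun i => \sum_a dot g p u (b a) * E i j a)).
apply: eq_bigr => i' _.
rewrite -(sum_delta_l (fun j => (i == i')%:R * \sum_a dot g p u (b a) * E i' j a)).
apply: eq_bigr => j' _; rewrite !mulr_sumr; apply: eq_bigr => a _.
by rewrite !ob; ring.
Qed.

Lemma phi_frame0 i j k : phi p (b i) (b j) (b k) = E i j k.
Proof.
rewrite phi_frame1 -[RHS](sum_delta_l (fun a => E a j k)).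
by apply: eq_bigr => a _; rewrite ob.
Qed.

Lemma cross_frame u i n : dot g p (cross p (b i) u) (b n) = \sum_x dot g p u (b x) * E
  i x n.
Proof. by rewrite crossP phi_frame2. Qed.

(** The matrix, in the orthonormal basis b, of the endomorphism u |-> u *m a. *)
Definition framemx (a : 'M[R]_7) : 'M[R]_7 := \matrix_(i, j) dot g p (b i *m a) (b j).
Local Notation hat := framemx.

Let Em : 'M[R]_7 := \matrix_i b i.

Lemma framemxE a : hat a = Em *m a *m gram g p *m Em^T.
Proof.
apply/matrixP => i j; rewrite [LHS]mxE /dot -(rowK b i) -(rowK b j) -!row_mul tr_row.
by rewrite [LHS]mxE [LHS]mxE [RHS]mxE; apply: eq_bigr => k _; rewrite [col _ _ _ _]mxE.
Qed.

Lemma framemxD a c : hat (a + c) = hat a + hat c.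
Proof. by rewrite !framemxE mulmxDr !mulmxDl. Qed.

Lemma framemx_scalar k : hat k%:M = k%:M.
Proof.
rewrite framemxE mul_mx_scalar -!scalemxAl (onb_mx ob).
by rewrite scalemx1.
Qed.

Lemma framemx_trace a : \tr (hat a) = \tr a.
Proof.
rewrite framemxE mxtrace_mulC !mulmxA -(onb_invmx_gram ob) -mulmxA mxtrace_mulC.
by rewrite -mulmxA mulmxV ?mulmx1 // (gram_unit ob).
Qed.

Lemma framemx_dot_endo a c : dot_endo g p a c = mx_dot (hat a) (hat c).
Proof.
have -> : mx_dot (hat a) (hat c) = \tr (hat a *m (hat c)^T).
  by apply: eq_bigr => i _; rewrite mxE; apply: eq_bigr => j _;
    rewrite [(hat c)^T _ _]mxE.
have PG : Em^T *m Em *m gram g p = 1%:M.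
  by rewrite -(onb_invmx_gram ob) mulVmx // (gram_unit ob).
rewrite !framemxE !trmx_mul trmxK gram_sym /dot_endo /adjoint_endo (onb_invmx_gram ob).
transitivity (\tr (a *m gram g p *m (Em^T *m Em *m gram g p) *m c^T *m (Em^T *m Em))).
  by rewrite PG mulmx1 !mulmxA.
by rewrite !mulmxA mxtrace_mulC !mulmxA.
Qed.

Lemma dot_framemx u a x : dot g p (u *m a) (b x) = \sum_i dot g p u (b i) * hat a i x.
Proof.
rewrite {1}(onb_expand ob u) mulmx_suml dot_suml; apply: eq_bigr => i _.
by rewrite -scalemxAl dotZl [hat a i x]mxE.
Qed.

Definition frame_endo (c : 'M[R]_7) : 'M[R]_7 := invmx Em *m c *m Em.

Lemma frame_endoK c : hat (frame_endo c) = c.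
Proof.
rewrite framemxE /frame_endo !mulmxA mulmxV ?(onb_unit ob) // mul1mx.
by rewrite -!mulmxA [Em *m _]mulmxA (onb_mx ob) mulmx1.
Qed.

Lemma skew_framemx a : skew_endo g p a <-> skew_mx (hat a).
Proof.
split=> [sa i j|sa u v]; first by rewrite !mxE sa dotC.
rewrite (onb_parseval ob) [in RHS]dotC (onb_parseval ob (v *m a)).
transitivity (\sum_i \sum_x dot g p u (b i) * dot g p v (b x) * hat a i x).
  rewrite exchange_big; apply: eq_bigr => x _; rewrite dot_framemx mulr_suml.
  by apply: eq_bigr => i _; ring.
rewrite -sumrN; apply: eq_bigr => i _; rewrite dot_framemx mulr_suml -sumrN.
by apply: eq_bigr => x _; rewrite [hat a i x]sa; ring.
Qed.

Lemma derphi_framemx a i j k : derphi (hat a) i j k =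
  phi p (b i *m a) (b j) (b k) + phi p (b i) (b j *m a) (b k)
    + phi p (b i) (b j) (b k *m a).
Proof.
rewrite phi_frame1 phi_frame2 phi_frame3 -!big_split; apply: eq_bigr => x _.
by rewrite !mxE.
Qed.

(** For a skew endomorphism a, a is a derivation of the cross product iff its
    action on phi vanishes, and phi can be tested on the frame. *)
Lemma g2_framemx a : in_g2 g cross p a <-> g2mx (hat a).
Proof.
have crossa u v w : skew_endo g p a ->
    dot g p (cross p u v *m a - (cross p (u *m a) v + cross p u (v *m a))) w =
    - (phi p (u *m a) v w + phi p u (v *m a) w + phi p u v (w *m a)).
  by move=> sa; rewrite dotBl dotDl !crossP sa crossP; ring.
split=> [[sa ga]|[sa ga]].
  split=> [|i j k]; first exact/skew_framemx.
  have := crossa (b i) (b j) (b k) sa; rewrite ga subrr dot0l derphi_framemx.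
  by move/eqP; rewrite eq_sym oppr_eq0 => /eqP.
have sa' := (skew_framemx a).2 sa; split=> // u v.
apply/eqP; rewrite -subr_eq0; apply/eqP; apply: (@dot_ext _ _ _ g p) => w.
rewrite crossa // dot0l; apply/eqP; rewrite oppr_eq0; apply/eqP.
transitivity (\sum_i \sum_j \sum_k dot g p u (b i) * dot g p v (b j) * dot g p w (b k) *
   derphi (hat a) i j k); last first.
  by do 3![apply: big1 => ? _]; rewrite ga mulr0.
pose x i := dot g p u (b i); pose y i := dot g p v (b i); pose z i := dot g p w (b i).
have e1 : phi p (u *m a) v w =
    \sum_i \sum_j \sum_k x i * y j * z k * \sum_l hat a i l * E l j k.
  transitivity (\sum_l \sum_j \sum_k \sum_i x i * y j * z k * (hat a i l * E l j k)).
    rewrite phi_frame; apply: eq_bigr => l _; apply: eq_bigr => j _;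
      apply: eq_bigr => k _.
    by rewrite dot_framemx !mulr_suml; apply: eq_bigr => i _; rewrite /x /y /z; ring.
  rewrite exchange_big [RHS]exchange_big; apply: eq_bigr => j _ /=.
  rewrite exchange_big [RHS]exchange_big; apply: eq_bigr => k _ /=.
  by rewrite exchange_big; apply: eq_bigr => i _ /=; rewrite mulr_sumr.
have e2 : phi p u (v *m a) w =
    \sum_i \sum_j \sum_k x i * y j * z k * \sum_l hat a j l * E i l k.
  transitivity (\sum_i \sum_l \sum_k \sum_j x i * y j * z k * (hat a j l * E i l k)).
    rewrite phi_frame; apply: eq_bigr => i _; apply: eq_bigr => l _;
      apply: eq_bigr => k _.
    by rewrite dot_framemx mulr_sumr !mulr_suml; apply: eq_bigr => j _;
      rewrite /x /y /z; ring.
  apply: eq_bigr => i _; rewrite exchange_big [RHS]exchange_big;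
    apply: eq_bigr => k _ /=.
  by rewrite exchange_big; apply: eq_bigr => j _ /=; rewrite mulr_sumr.
have e3 : phi p u v (w *m a) =
    \sum_i \sum_j \sum_k x i * y j * z k * \sum_l hat a k l * E i j l.
  transitivity (\sum_i \sum_j \sum_l \sum_k x i * y j * z k * (hat a k l * E i j l)).
    rewrite phi_frame; apply: eq_bigr => i _; apply: eq_bigr => j _;
      apply: eq_bigr => l _.
    by rewrite dot_framemx mulr_sumr !mulr_suml; apply: eq_bigr => k _;
      rewrite /x /y /z; ring.
  apply: eq_bigr => i _; apply: eq_bigr => j _; rewrite exchange_big;
    apply: eq_bigr => k _ /=.
  by rewrite mulr_sumr.
rewrite e1 e2 e3; do 3![rewrite -!big_split /=; apply: eq_bigr => ? _].
by rewrite -!mulrDr /derphi !big_split.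
Qed.

Lemma g2_perp_framemx a : in_g2_perp g cross p a ->
  skew_mx (hat a) /\ forall c, g2mx c -> mx_dot (hat a) c = 0.
Proof.
move=> [sa pa]; split=> [|c gc]; first exact/skew_framemx.
by rewrite -(frame_endoK c) -framemx_dot_endo; apply/pa/g2_framemx; rewrite frame_endoK.
Qed.

Lemma sqnorm_frame a : sqnorm_xi g cross p b a = 6%:R * sqnorm_mx (hat a).
Proof.
rewrite -sum_cross_sq; apply: eq_bigr => i _; apply: eq_bigr => j _.
rewrite (onb_parseval ob); apply: eq_bigr => n _; rewrite cross_frame expr2.
by congr (_ * _); apply: eq_bigr => x _; rewrite [hat a i x]mxE.
Qed.

(** The squared norm of xi_(k) is 6 times that of T_(k), so this is
    components_norm in the frame. *)
Lemma components_frame a a1 a2 a3 a4 : g2_components g cross p a a1 a2 a3 a4 ->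
  9%:R * sqnorm_xi g cross p b a1 - 3%:R / 2%:R * sqnorm_xi g cross p b a2
  - 3%:R / 2%:R * sqnorm_xi g cross p b a3 + 15%:R / 2%:R * sqnorm_xi g cross p b a4 =
  9%:R * ((\tr (hat a)) ^+ 2 - (\sum_i \sum_j hat a i j ^+ 2)
    + \sum_n phi_contr (hat a) n ^+ 2).
Proof.
move=> [aE a1E g2 [s3 t3] p4]; have [sk4 pp4] := g2_perp_framemx p4.
rewrite -(@components_norm _ (hat a) (hat a1) (hat a2) (hat a3) (hat a4)) //.
- by rewrite !sqnorm_frame; field.
- by rewrite aE !framemxD.
- by rewrite a1E framemx_scalar framemx_trace.
- exact/g2_framemx.
- by move=> i j; rewrite !mxE s3 dotC.
- by rewrite framemx_trace.
Qed.

(** The right-hand side does not mention the orthonormal basis b'. *)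
Lemma trace_xi_gram (xi : M -> 'rV[R]_7 -> 'M[R]_7) T b' : torsion_endo cross xi T ->
  orthonormal_basis g p b' ->
  trace_xi xi p b' = \sum_k \sum_l invmx (gram g p) k l *:
    (delta_mx 0 k *m xi p (delta_mx 0 l)).
Proof.
move=> Txi ob'.
have xiL (y v v' : 'rV[R]_7) (c : R) : y *m xi p (c *: v + v') = c *: (y *m xi p v)
  + y *m xi p v'.
  apply: (@dot_ext _ _ _ g p) => z; rewrite dotDl dotZl !Txi !crossP !phi_frame.
  do 3![rewrite mulr_sumr -big_split /=; apply: eq_bigr => ? _].
  by rewrite mulmxDl -scalemxAl dotDl dotZl; ring.
have xiE (y v : 'rV[R]_7) : y *m xi p v = \sum_l v 0 l *: (y *m xi p (delta_mx 0 l)).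
  pose LM := GRing.isLinear.Build _ _ _ _ _ (fun c v v' => xiL y v v' c).
  pose L : {linear 'rV[R]_7 -> 'rV[R]_7} := HB.pack (fun v => y *m xi p v) LM.
  exact: (linear_row_sum L).
transitivity (\sum_i \sum_k \sum_l (b' i 0 k * b' i 0 l) *:
    ((delta_mx 0 k : 'rV[R]_7) *m xi p (delta_mx 0 l))).
  apply: eq_bigr => i _; rewrite {1}(row_sum_delta (b' i)) mulmx_suml.
  apply: eq_bigr => k _; rewrite -scalemxAl xiE scaler_sumr.
  by apply: eq_bigr => l _; rewrite scalerA.
rewrite exchange_big; apply: eq_bigr => k _; rewrite exchange_big;
  apply: eq_bigr => l _ /=.
by rewrite -scaler_suml (onb_gram_sum ob').
Qed.

End Pointwise.
End G2.

(** * The torsion in a Cayley frame *)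

Section CayleyFrame.
Context {R : realType} {M : manifold R 7}.
Variables (g : riemannian_metric M)
  (phi : M -> 'rV[R]_7 -> 'rV[R]_7 -> 'rV[R]_7 -> R)
  (cross : M -> 'rV[R]_7 -> 'rV[R]_7 -> 'rV[R]_7)
  (nabla nablaG : (M -> 'rV[R]_7) -> M -> 'rV[R]_7 -> 'rV[R]_7)
  (xi : M -> 'rV[R]_7 -> 'M[R]_7) (T : M -> 'M[R]_7).
Local Notation E i j k := ((eps i j k)%:~R : R).
Local Notation Phi := (crossmx R).
Hypothesis crossP : cross_product g phi cross.
Hypothesis lc : levi_civita g nabla.
Hypothesis mc : minimal_connection g phi cross nabla nablaG xi.
Hypothesis Txi : torsion_endo cross xi T.
Variables (U : set M) (e : M -> 'I_7 -> 'rV[R]_7).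
Hypothesis oU : open U.
Hypothesis cf : cayley_frame g phi U e.

Let se i : smooth_field U (e^~ i). Proof. by case: cf. Qed.
Let oe q : U q -> orthonormal_basis g q (e q). Proof. by case: cf => _ + _; apply. Qed.
Let pe q : U q -> forall u v w, phi q u v w = \sum_(i : 'I_7)
  wedge3 (dual_basis (e q) i) (dual_basis (e q) (i + 1)) (dual_basis (e q) (i
    + 3)) u v w.
Proof. by case: cf => _ _; apply. Qed.
Let cn : is_connection nabla. Proof. by case: lc. Qed.
Let mn : metric_connection g nabla. Proof. by case: lc. Qed.
Let cG : is_connection nablaG. Proof. by case: mc. Qed.
Let mG : metric_connection g nablaG. Proof. by case: mc => _ []. Qed.
Let pG : parallel_form phi nablaG. Proof. by case: mc => _ []. Qed.
Let dG V Y : open V -> smooth_field V Y -> forall p v, V p ->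
  Y p *m xi p v = nablaG Y p v - nabla Y p v.
Proof. by case: mc => _ _ + _; apply. Qed.

Local Notation A := (conn_coef g e nabla).
Local Notation B := (conn_coef g e nablaG).

(** phi has constant components in a Cayley frame and is parallel for the
    minimal connection. *)
Lemma conn_coef_g2 q v : U q -> g2mx (B q v).
Proof.
move=> Uq; split=> [i j|i j k]; first exact: (conn_coef_skew oU se oe).
have := pG oU (se i) (se j) (se k) v Uq.
rewrite (phi_frame1 (oe Uq) (pe Uq)) (phi_frame2 (oe Uq) (pe Uq)) (phi_frame3 (oe Uq)
  (pe Uq)).
rewrite -!big_split /= => H;
  transitivity (tdiff (fun q => phi q (e q i) (e q j) (e q k)) q v).
  by rewrite H; apply: eq_bigr => x _; rewrite !mxE.
rewrite -(tdiff_cst (M := M) (E i j k) q v).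
apply: (tdiff_eq _ oU Uq (smooth_map_cst U (E i j k))) => q' Uq'.
by rewrite (phi_frame0 (oe Uq') (pe Uq')).
Qed.

Lemma conn_coef_diff q v : U q ->
  B q v - A q v = \sum_x dot g q (v *m T q) (e q x) *: Phi x.
Proof.
move=> Uq; apply/matrixP => k l; rewrite mxBE summxE !mxE -dotBl -(dG oU (se k) v Uq).
rewrite Txi (cross_frame crossP (oe Uq) (pe Uq)).
by apply: eq_bigr => x _; rewrite !mxE.
Qed.

(** The minimal connection does not contribute to the contraction with phi, so
    the torsion is a contraction of the Levi-Civita connection matrices alone.
    In particular it is smooth. *)
Lemma torsion_coef q v m : U q ->
  dot g q (v *m T q) (e q m) = 6%:R^-1 * \sum_k \sum_l E k l m * A q v k l.
Proof.
move=> Uq; have : \tr (Phi m *m (B q v - A q v)) = - 6%:R * dot g q (v *m T q) (e q m).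
  rewrite conn_coef_diff // mulmx_sumr raddf_sum /=.
  rewrite -(sum_delta_l (fun x => - 6%:R * dot g q (v *m T q) (e q x))).
  by apply: eq_bigr => x _; rewrite -scalemxAr mxtraceZ tr_crossmx2; ring.
rewrite mulmxBr raddfB /= g2mx_tr ?tr_crossmx; last exact: conn_coef_g2.
by lra.
Qed.

Definition torsion_mx q : 'M[R]_7 := framemx g q (e q) (T q).

Lemma torsion_mx_smooth i m : smooth_map U (fun q => torsion_mx q i m).
Proof.
have H : smooth_map U (fun q => \sum_k \sum_l (6%:R^-1 * E k l m) *
    dot g q (nabla (e^~ k) q (e q i)) (e q l)).
  apply: (smooth_map_sum _ oU) => k; apply: (smooth_map_sum _ oU) => l.
  apply: (smooth_mapM oU (smooth_map_cst U _)).
  exact: (smooth_dot g oU (nabla_smooth cn oU (se i) (se k)) (se l)).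
apply: smooth_map_eq oU _ H => q Uq;
  rewrite [torsion_mx q i m]mxE torsion_coef // mulr_sumr.
apply: eq_bigr => k _; rewrite mulr_sumr; apply: eq_bigr => l _.
by rewrite mxE mulrA.
Qed.

Variable p : M.
Hypothesis Up : U p.
Let D := chart_dom (chart_at p).
Let oD : open D. Proof. exact: chart_dom_open. Qed.
Let V := U `&` D.
Let oV : open V. Proof. exact: openI. Qed.
Let Vp : V p. Proof. by split; last exact: chart_at_dom. Qed.
Local Notation X_ u := (coord_field p u).
Let sX v : smooth_field V (X_ v).
Proof. exact: smooth_field_sub (@subIsetr _ U D) (coord_field_smooth p v). Qed.
Let seV i : smooth_field V (e^~ i).
Proof. exact: smooth_field_sub (@subIsetl _ U D) (se i). Qed.

(** The coordinate field X_ (e p j) equals e_j only at p. Its components in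
    the frame have derivatives at p, which produce the sum over y: a term
    symmetric in u and e_j, and a term in the connection matrix. *)
Lemma conn_coef_contr_diff u j m :
  \sum_k \sum_l E k l m * tdiff (fun q => A q (X_ (e p j) q) k l) p u =
  6%:R * (tdiff (fun q => torsion_mx q j m) p u +
    \sum_y (dot g p (nabla (X_ (e p j)) p u) (e p y) + A p u y j) * torsion_mx p y m).
Proof.
have sA k l := conn_coef_smooth g oU se p (e p j) k l cn.
have sf y : smooth_map V (fun q => dot g q (X_ (e p j) q) (e q y)).
  exact: (smooth_dot g oV (sX _) (seV y)).
have st i : smooth_map V (fun q => torsion_mx q i m).
  exact: smooth_map_sub (@subIsetl _ U D) (torsion_mx_smooth i m).
transitivity (tdiff (fun q => \sum_k \sum_l E k l m * A q (X_ (e p j) q) k l) p u).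
  have sEA k l : smooth_map V (fun q => E k l m * A q (X_ (e p j) q) k l).
    exact: (smooth_mapM oV (smooth_map_cst V _) (sA k l)).
  rewrite (tdiff_sum _ _ oV Vp); last by move=> k; exact: (smooth_map_sum _ oV).
  apply: eq_bigr => k _; rewrite (tdiff_sum _ _ oV Vp); last by [].
  apply: eq_bigr => l _.
  rewrite (tdiffM _ Vp (smooth_map_cst V _) (sA k l)).
  by rewrite tdiff_cst mul0r add0r.
have sft y : smooth_map V (fun q => dot g q (X_ (e p j) q) (e q y) * torsion_mx q y m).
  exact: (smooth_mapM oV (sf y) (st y)).
have sS := smooth_map_sum (index_enum 'I_7) oV sft.
transitivity (tdiff (fun q => 6%:R * \sum_y dot g q (X_ (e p j) q) (e q y) *
  torsion_mx q y m) p u).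
  apply: (tdiff_eq _ oV Vp) (smooth_mapM oV (smooth_map_cst V _) sS) _ => q [Uq Dq].
  rewrite -(dot_framemx (oe Uq)) torsion_coef //.
  by rewrite mulrA mulfV ?mul1r // pnatr_eq0.
rewrite (tdiffM _ Vp (smooth_map_cst V _) sS) tdiff_cst mul0r add0r; congr (_ * _).
rewrite (tdiff_sum _ _ oV Vp sft) -(sum_delta_l (fun y => tdiff (fun q => torsion_mx q
  y m) p u)).
rewrite -big_split; apply: eq_bigr => y _ /=.
rewrite (tdiffM _ Vp (sf y) (st y)) (coord_frame_diff oU se lc Up) coord_field_center.
rewrite (oe Up) addrC; congr ((_ + _) * _ + _).
by rewrite dotC mxE.
Qed.

Let W q := trace_xi xi q (e q).

(** xi is the difference of two connections, both of which preserve
    smoothness. *)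
Lemma trace_xi_smooth : smooth_field U W.
Proof.
have H : smooth_field U (fun q => \sum_i (nablaG (e^~ i) q (e q i) - nabla (e^~ i) q
  (e q i))).
  apply: (smooth_field_sum _ oU) => i; apply: (smooth_fieldD oU).
    exact: (nabla_smooth cG oU (se i) (se i)).
  apply: (smooth_fieldN oU); exact: (nabla_smooth cn oU (se i) (se i)).
apply: smooth_field_eq oU _ H => q Uq.
by apply: eq_bigr => i _; rewrite -(dG oU (se i)).
Qed.

Lemma dot_trace_xi q n : U q -> dot g q (W q) (e q n) = phi_contr (torsion_mx q) n.
Proof.
move=> Uq; rewrite dot_suml; apply: eq_bigr => i _.
rewrite Txi (cross_frame crossP (oe Uq) (pe Uq)).
by apply: eq_bigr => x _; rewrite mulrC [torsion_mx q i x]mxE.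
Qed.

Lemma divergence_trace_xi : divergence nabla W p =
  \sum_i \sum_j \sum_m E i j m * tdiff (fun q => torsion_mx q j m) p (e p i)
  - \sum_k \sum_n phi_contr (torsion_mx p) n * A p (e p k) k n.
Proof.
rewrite (divergence_frame oU se oe lc Up trace_xi_smooth) -sumrB; apply: eq_bigr => k _.
congr (_ - _); last by apply: eq_bigr => n _; rewrite dot_trace_xi.
have sE a b : smooth_map U (fun q => E a b k * torsion_mx q a b).
  exact: (smooth_mapM oU (smooth_map_cst U _) (torsion_mx_smooth a b)).
have sS a := smooth_map_sum (index_enum 'I_7) oU (sE a).
transitivity (tdiff (fun q => phi_contr (torsion_mx q) k) p (e p k)).
  have H := smooth_map_sum (index_enum 'I_7) oU sS.
  by apply: (tdiff_eq _ oU Up H) => q Uq; rewrite dot_trace_xi.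
rewrite (tdiff_sum _ _ oU Up sS); apply: eq_bigr => a _.
rewrite (tdiff_sum _ _ oU Up (sE a)); apply: eq_bigr => b _.
rewrite (tdiffM _ Up (smooth_map_cst U _) (torsion_mx_smooth a b)).
by rewrite tdiff_cst mul0r add0r epsR_cyc.
Qed.

(** The scalar curvature formula before the torsion is split into components. *)
Lemma scalar_curvature_torsion : scalar_curvature g nabla p =
  9%:R * ((\tr (torsion_mx p)) ^+ 2 - (\sum_a \sum_b torsion_mx p a b ^+ 2)
    + \sum_n phi_contr (torsion_mx p) n ^+ 2)
  - 6%:R * divergence nabla W p.
Proof.
rewrite (scalar_curvature_onb lc (oe Up)) divergence_trace_xi.
pose Rm i j k l := dot g p (curvature_at nabla p (e p i) (e p j) (e p k)) (e p l).
apply: (@scalar_identity _ (torsion_mx p) (fun i => A p (e p i)) (fun i => B p (e p i))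
  (fun i => B p (e p i) - A p (e p i)) (fun i j m => tdiff (fun q => torsion_mx q j m)
    p (e p i))
  (fun i j y => dot g p (nabla (X_ (e p j)) p (e p i)) (e p y)) Rm).
- move=> i; rewrite conn_coef_diff //; apply: eq_bigr => x _.
  by rewrite [torsion_mx p i x]mxE.
- by move=> i; rewrite opprB addrC subrK.
- by move=> i; exact: conn_coef_g2.
- by move=> i j k l; rewrite /Rm -!dotDl (bianchi lc) dot0l.
- by move=> i j k l; rewrite /Rm (curvature_antisym lc) dotNl.
- move=> i j y; congr (dot g p _ _).
  have := nabla_coord_sym lc (e p i) (e p j) (chart_at_dom p).
  by rewrite !coord_field_center => ->.
move=> i j m; rewrite -!conn_coef_contr_diff tr_crossmx -!sumrB.
apply: eq_bigr => k _; rewrite -!sumrB; apply: eq_bigr => l _.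
rewrite /Rm -(curvature_tensorial oU se lc Up) (curvature_frame oU se oe lc Up).
by ring.
Qed.

End CayleyFrame.

Theorem mainTheorem2 (R : realType) (M : manifold R 7) (g : riemannian_metric M)
    (phi : M -> 'rV[R]_7 -> 'rV[R]_7 -> 'rV[R]_7 -> R)
    (cross : M -> 'rV[R]_7 -> 'rV[R]_7 -> 'rV[R]_7)
    (nabla nablaG : (M -> 'rV[R]_7) -> M -> 'rV[R]_7 -> 'rV[R]_7)
    (xi : M -> 'rV[R]_7 -> 'M[R]_7)
    (T T1 T2 T3 T4 : M -> 'M[R]_7) :
  g2_structure g phi ->
  cross_product g phi cross ->
  levi_civita g nabla ->
  minimal_connection g phi cross nabla nablaG xi ->
  torsion_endo cross xi T ->
  (forall p, g2_components g cross p (T p) (T1 p) (T2 p) (T3 p) (T4 p)) ->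
  (forall (U : set M) (e : M -> 'I_7 -> 'rV[R]_7),
     open U -> cayley_frame g phi U e ->
     forall p, U p ->
     scalar_curvature g nabla p =
       9%:R * sqnorm_xi g cross p (e p) (T1 p)
       - 3%:R / 2%:R * sqnorm_xi g cross p (e p) (T2 p)
       - 3%:R / 2%:R * sqnorm_xi g cross p (e p) (T3 p)
       + 15%:R / 2%:R * sqnorm_xi g cross p (e p) (T4 p)
       - 6%:R * divergence nabla (fun q => trace_xi xi q (e q)) p)
  /\ (forall p (b b' : 'I_7 -> 'rV[R]_7),
        orthonormal_basis g p b -> orthonormal_basis g p b' ->
        trace_xi xi p b = trace_xi xi p b').
Proof.
move=> g2s crossP lc mc Txi comp; split=> [U e oU cf p Up|p b b' ob ob'].
  rewrite (scalar_curvature_torsion crossP lc mc Txi oU cf Up).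
  have [_ oe pe] := cf.
  by rewrite (components_frame crossP (oe p Up) (pe p Up) (comp p)).
have [U [e [oU Up [_ oe pe]]]] := g2s p.
by rewrite !(trace_xi_gram crossP (oe p Up) (pe p Up) Txi).
Qed.
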